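(* Let $\mathbb K$ be a nonarchimedean local field with residue field of order $q$, and let $\Gamma$ be a subgroup of $\mathrm{PGL}_3(\mathbb K)$ which is an $\widetilde A_2$ group of Tits type, acting on the Bruhat-Tits building of $\mathrm{PGL}_3(\mathbb K)$. If $q\not\equiv 1\pmod 3$, then the class $[\mathbf 1]$ of the constant function $\mathbf 1$ in the module of coinvariants $C(\mathbb P^2_{\mathbb K},\mathbb Z)_\Gamma$ has order exactly $q-1$.
   Context: $\mathbb P^2_{\mathbb K}$ is the set of one-dimensional subspaces of $\mathbb K^3$, a compact totally disconnected space with the topology inherited from $\mathbb K$, with the natural action of $\mathrm{PGL}_3(\mathbb K)$. $C(\mathbb P^2_{\mathbb K},\mathbb Z)$ is the group of continuous integer-valued functions, a $\Gamma$-module via $(g\cdot f)(\xi)=f(g^{-1}\xi)$; $C(\mathbb P^2_{\mathbb K},\mathbb Z)_\Gamma=H_0(\Gamma;C(\mathbb P^2_{\mathbb K},\mathbb Z))$ is its quotient by the submodule generated by all $g\cdot f-f$. **Bruhat-Tits building.** Let $\mathcal O$ be the ring of integers of $\mathbb K$ and $\pi$ a uniformizer. The vertices of the Bruhat-Tits building $\Delta$ of $\mathrm{PGL}_3(\mathbb K)$ are the classes $[L]$, up to scaling by $\mathbb K^\times$, of lattices $L$ (rank-3 $\mathcal O$-submodules spanned by a basis of $\mathbb K^3$). Chambers are the sets $\{[L_0],[L_1],[L_2]\}$ with $L_0\subset L_1\subset L_2\subset\pi^{-1}L_0$ (strict inclusions). Vertices carry types in $\mathbb Z/3\mathbb Z$,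 increasing by $1$ from $[L_0]$ to $[L_1]$ when $L_0\subset L_1\subset\pi^{-1}L_0$ with $L_0$ maximal in $L_1$; each edge is directed from its vertex of type $i$ to its vertex of type $i+1$. A subgroup of $\mathrm{PGL}_3(\mathbb K)$ is an $\widetilde A_2$ group if it acts freely and transitively on the vertices of $\Delta$. **Tits type.** Let $P=\mathbb F_{q^3}^\times/\mathbb F_q^\times$, let $\mathrm{Tr}(a)=a+a^q+a^{q^2}$ be the trace $\mathbb F_{q^3}\to\mathbb F_q$, and for $\xi=\mathbb F_q^\times\xi_0\in P$ write $\mathrm{Tr}(\xi)=0$ if $\mathrm{Tr}(\xi_0)=0$. Put $\mathcal T_0=\{(x,x\xi,x\xi^{q+1}) : x,\xi\in P,\ \mathrm{Tr}(\xi)=0\}$ and $\Gamma_{\mathcal T_0}=\langle P\mid xyz=1,\ (x,y,z)\in\mathcal T_0\rangle$. The Cayley graph of $\Gamma_{\mathcal T_0}$ with respect to $P$ is the 1-skeleton of an $\widetilde A_2$ building $\Delta_{\mathcal T_0}$, with directed edges $(a,ax)$ and chambers $\{a,ax,axy\}$ ($a\in\Gamma_{\mathcal T_0}$, $(x,y,z)\in\mathcal T_0$), on which $\Gamma_{\mathcal T_0}$ acts by left multiplication. $\Gamma$ is of Tits type if $\Gamma$ with its action on $\Delta$ is isomorphic to $\Gamma_{\mathcal T_0}$ with its action on $\Delta_{\mathcal T_0}$, by an equivariant simplicial isomorphism $\Delta_{\mathcal T_0}\to\Delta$ preserving edge directions. *)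

(* Defs.v *)
From HB Require Import structures.
From mathcomp Require Import all_boot all_order all_fingroup all_algebra.
From mathcomp Require Import generic_quotient.
From mathcomp Require Import all_classical all_reals topology.

Set Implicit Arguments.
Unset Strict Implicit.
Unset Printing Implicit Defensive.

Import Order.TTheory GRing.Theory Num.Theory.

Local Open Scope classical_set_scope.
Local Open Scope quotient_scope.
Local Open Scope ring_scope.

(* A complete uniform space that is also a field, whose uniformity is given by
   a normalized discrete valuation (with value +oo at 0) having finite residue
   field. *)
HB.mixin Record isNonarchLocalField K of GRing.Field K & Complete K := {
  valuation : K -> \bar int;
  valuation_pinfty : forall x, (valuation x == +oo%E) = (x == 0);
  valuation_ninfty : forall x, valuation x != -oo%E;
  valuationM : forall x y, valuation (x * y) = (valuation x + valuation y)%E;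
  valuationD : forall x y,
    (mine (valuation x) (valuation y) <= valuation (x + y)%R)%E;
  valuation1 : exists p, valuation p = 1%E;
  valuation_entourage : forall A : set (K * K),
    entourage A <->
    exists n : int, [set xy | (n%:E <= valuation (xy.1 - xy.2)%R)%E] `<=` A;
  residue_finite : finite_set
    [set [set y | (0 < valuation (y - x)%R)%E] | x in [set x | (0 <= valuation x)%E]]
}.

#[short(type="nonarchLocalFieldType")]
HB.structure Definition NonarchLocalField :=
  {K of isNonarchLocalField K & GRing.Field K & Complete K}.

Section LocalField.
Variable K : nonarchLocalFieldType.

Definition integers : set K := [set x | (0 <= valuation x)%E].

Definition uniformizer (p : K) : Prop := valuation p = 1%E.

(* The cosets in [integers] of its maximal ideal. *)
Definition residue_field : set (set K) :=
  [set [set y | (0 < valuation (y - x)%R)%E] | x in integers].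

Lemma valuation0 : valuation (0 : K) = +oo%E.
Proof. by apply/eqP; rewrite valuation_pinfty. Qed.

Lemma nbhs_valuationP (x : K) (U : set K) :
  nbhs x U <-> exists n : int, [set y | (n%:E <= valuation (x - y)%R)%E] `<=` U.
Proof.
rewrite -nbhs_entourageE; split.
  move=> [A /valuation_entourage[n nA] AU]; exists n => y /= ny.
  by apply: AU; apply/xsectionP; apply: nA.
move=> [n nU]; exists [set xy | (n%:E <= valuation (xy.1 - xy.2)%R)%E].
  by apply/valuation_entourage; exists n.
by move=> y /xsectionP /= ?; apply: nU.
Qed.

Lemma nbhs_scaled_entry m (a : K) (x : 'cV[K]_m) (k : 'I_m) (n : int) :
  nbhs x [set y | (n%:E <= valuation (a * (x k 0 - y k 0))%R)%E].
Proof.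
have [->|a0] := eqVneq a 0.
  by apply: filterS filterT => y _ /=; rewrite mul0r valuation0 leey.
case va: (valuation a) => [r||]; last 2 first.
- by move/eqP: va; rewrite valuation_pinfty (negbTE a0).
- by move/eqP: va; rewrite (negbTE (valuation_ninfty _)).
exists (fun i j => [set z | ((n - r)%R%:E <= valuation (x i j - z)%R)%E]).
  by move=> i j; apply/nbhs_valuationP; exists (n - r).
move=> y /(_ k 0) /= ny; rewrite valuationM va.
case: (valuation _) ny => [s||] //=.
  by rewrite -EFinD !lee_fin lerBlDl.
by move=> _; rewrite addey // leey.
Qed.

Lemma mulmx_continuous m p (A : 'M[K]_(p, m)) :
  continuous (mulmx A : 'cV[K]_m -> 'cV[K]_p).
Proof.
move=> x W [P nP PW].
suff H : nbhs x [set y | forall i j, P i j ((A *m y) i j)].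
  by apply: filterS H => y Py; apply: PW.
apply: (@filter_forall _ _ (fun i => [set y | forall j, P i j ((A *m y) i j)])
  (nbhs x)) => i.
apply: (@filter_forall _ _ (fun j => [set y | P i j ((A *m y) i j)])
  (nbhs x)) => j.
have /nbhs_valuationP[n nPij] := nP i j.
suff H : nbhs x [set y : 'cV[K]_m |
    (n%:E <= valuation (\sum_(k < m) A i k * (x k 0 - y k 0))%R)%E].
  apply: filterS H => y /= ny; apply: nPij; rewrite /= !mxE -sumrB.
  rewrite (ord1 j); under eq_bigr do rewrite -mulrBr.
  exact: ny.
elim: (index_enum _) => [|k s IHs].
  by apply: filterS filterT => y _ /=; rewrite big_nil valuation0 leey.
apply: filterS2 (nbhs_scaled_entry (A i k) x k n) IHs => y /= h1 h2.
rewrite big_cons; apply: le_trans (valuationD _ _).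
by rewrite le_min h1.
Qed.

End LocalField.

Arguments residue_field : clear implicits.

Section ProjectiveLinearGroup.
Variable K : fieldType.

Definition GL3 := {A : 'M[K]_3 | A \in unitmx}.

HB.instance Definition _ := Choice.on GL3.

Definition gl_one : GL3 := exist _ 1%:M (unitmx1 K 3).

Definition gl_mul (A B : GL3) : GL3 :=
  exist _ (val A *m val B)
    (etrans (unitmx_mul _ _) (introT andP (conj (valP A) (valP B)))).

Definition gl_inv (A : GL3) : GL3 :=
  exist _ (invmx (val A)) (etrans (unitmx_inv _) (valP A)).

Lemma gl_mulA : associative gl_mul.
Proof. by move=> A B C; apply: val_inj; rewrite /= mulmxA. Qed.
Lemma gl_mul1 : left_id gl_one gl_mul.
Proof. by move=> A; apply: val_inj; rewrite /= mul1mx. Qed.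
Lemma gl_1mul : right_id gl_one gl_mul.
Proof. by move=> A; apply: val_inj; rewrite /= mulmx1. Qed.
Lemma gl_mulV : left_inverse gl_one gl_inv gl_mul.
Proof. by move=> A; apply: val_inj; rewrite /= mulVmx // (valP A). Qed.
Lemma gl_Vmul : right_inverse gl_one gl_inv gl_mul.
Proof. by move=> A; apply: val_inj; rewrite /= mulmxV // (valP A). Qed.

HB.instance Definition _ :=
  isGroup.Build GL3 gl_mulA gl_mul1 gl_1mul gl_mulV gl_Vmul.

Definition proportional : rel GL3 :=
  fun A B => `[< exists2 c : K, c != 0 & val A = c *: val B >].

Lemma proportional_equiv : equiv_class_of proportional.
Proof.
split=> [A|A B|B A C].
- by apply/asboolP; exists 1; rewrite ?oner_neq0 ?scale1r.
- apply: asbool_equiv_eq; split=> -[c c0 E]; exists c^-1;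
    by rewrite ?invr_eq0 // E scalerA mulVf // scale1r.
- move=> /asboolP[c c0 E] /asboolP[d d0 E']; apply/asboolP; exists (c * d).
    by rewrite mulf_neq0.
  by rewrite E E' scalerA.
Qed.

Canonical proportional_equiv_rel := EquivRelPack proportional_equiv.

Definition PGL3 := {eq_quot proportional}.

HB.instance Definition _ := EqQuotient.on PGL3.
HB.instance Definition _ := Choice.on PGL3.

Definition pgl_one : PGL3 := \pi_PGL3 1%g.
Definition pgl_mul (g h : PGL3) : PGL3 := \pi_PGL3 (repr g * repr h)%g.
Definition pgl_inv (g : PGL3) : PGL3 := \pi_PGL3 (repr g)^-1%g.

Lemma pgl_eqP (A B : GL3) :
  reflect (exists2 c : K, c != 0 & val A = c *: val B)
          (\pi_PGL3 A == \pi_PGL3 B).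
Proof. by rewrite eqmodE; exact: asboolP. Qed.

Lemma pgl_reprP (A : GL3) :
  exists2 c : K, c != 0 & val (repr (\pi_PGL3 A)) = c *: val A.
Proof. by apply/pgl_eqP; rewrite reprK. Qed.

Lemma pgl_mulE (A B : GL3) :
  pgl_mul (\pi A) (\pi B) = \pi_PGL3 (A * B)%g.
Proof.
apply/eqP/pgl_eqP; have [c c0 /= ->] := pgl_reprP A.
have [d d0 /= ->] := pgl_reprP B; exists (d * c); first by rewrite mulf_neq0.
by rewrite -scalemxAl -scalemxAr !scalerA mulrC.
Qed.

Lemma pgl_invE (A : GL3) : pgl_inv (\pi A) = \pi_PGL3 A^-1%g.
Proof.
apply/eqP/pgl_eqP; have [c c0 /= ->] := pgl_reprP A.
exists c^-1; first by rewrite invr_eq0.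
by rewrite invmxZ // unitmxZ ?unitfE // (valP A).
Qed.

Lemma pgl_mulA : associative pgl_mul.
Proof.
elim/quotW=> A; elim/quotW=> B; elim/quotW=> C.
by rewrite !pgl_mulE mulgA.
Qed.
Lemma pgl_mul1 : left_id pgl_one pgl_mul.
Proof. by elim/quotW=> A; rewrite pgl_mulE mul1g. Qed.
Lemma pgl_1mul : right_id pgl_one pgl_mul.
Proof. by elim/quotW=> A; rewrite pgl_mulE mulg1. Qed.
Lemma pgl_mulV : left_inverse pgl_one pgl_inv pgl_mul.
Proof. by elim/quotW=> A; rewrite pgl_invE pgl_mulE mulVg. Qed.
Lemma pgl_Vmul : right_inverse pgl_one pgl_inv pgl_mul.
Proof. by elim/quotW=> A; rewrite pgl_invE pgl_mulE mulgV. Qed.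

HB.instance Definition _ :=
  isGroup.Build PGL3 pgl_mulA pgl_mul1 pgl_1mul pgl_mulV pgl_Vmul.

End ProjectiveLinearGroup.

Section ProjectivePlane.
Variable K : nonarchLocalFieldType.

Definition P2 := {U : {vspace 'cV[K]_3} | \dim U == 1%N}.

HB.instance Definition _ := Choice.on P2.

Lemma dim_line_of (x : set_type [set x : 'cV[K]_3 | x != 0]) :
  \dim <[val x]>%VS == 1%N.
Proof. by rewrite dim_vline; have /= -> := set_valP x. Qed.

Definition line_of (x : set_type [set x : 'cV[K]_3 | x != 0]) : P2 :=
  exist _ <[val x]>%VS (dim_line_of x).

(* The quotient topology along line_of : K^3 \ {0} -> P2. *)
Definition P2_open (U : set P2) : Prop := open (line_of @^-1` U).

Lemma P2_openT : P2_open setT.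
Proof. by rewrite /P2_open preimage_setT; exact: openT. Qed.
Lemma P2_openI : setI_closed P2_open.
Proof. by move=> U V oU oV; exact: openI. Qed.
Lemma P2_open_bigcup (I : Type) (f : I -> set P2) :
  (forall i, P2_open (f i)) -> P2_open (\bigcup_i f i).
Proof.
move=> oF; rewrite /P2_open preimage_bigcup.
by apply: bigcup_open => i _; exact: oF.
Qed.

HB.instance Definition _ :=
  isOpenTopological.Build P2 P2_openT P2_openI P2_open_bigcup.

Lemma dim_limg_GL3 (A : GL3 K) (U : P2) :
  \dim (linfun (mulmx (val A) : 'cV[K]_3 -> 'cV[K]_3) @: val U) == 1%N.
Proof.
rewrite limg_dim_eq ?(valP U) //; apply/eqP; rewrite -subv0.
apply/subvP => x; rewrite memv_cap memv_ker memv0 lfunE /= => /andP[_ /eqP Ax].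
by rewrite -(mulKmx (valP A) x) Ax mulmx0.
Qed.

Definition P2_act (g : PGL3 K) (U : P2) : P2 :=
  exist _ (linfun (mulmx (val (repr g)) : 'cV[K]_3 -> 'cV[K]_3) @: val U)%VS
    (dim_limg_GL3 (repr g) U).

Lemma P2_act_continuous (g : PGL3 K) : continuous (P2_act g).
Proof.
apply/continuousP => U oU.
rewrite /open /= /P2_open.
case: oU => W oW WE; exists (mulmx (val (repr g)) @^-1` W).
  by apply: open_comp => // x _; exact: mulmx_continuous.
apply/funext => x /=.
have gx : val (repr g) *m val x != 0.
  apply/eqP => gx0; have /eqP[] := set_valP x.
  by rewrite -(mulKmx (valP (repr g)) (val x)) gx0 mulmx0.
have gx_in : val (repr g) *m val x \in [set x : 'cV[K]_3 | x != 0].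
  exact: mem_set.
pose y : set_type [set x : 'cV[K]_3 | x != 0] :=
  SigSub gx_in.
have -> : P2_act g (line_of x) = line_of y.
  by apply: val_inj; rewrite /= limg_line lfunE.
by rewrite -[U (line_of y)]/((line_of @^-1` U) y) -WE /= set_valE.

Qed.

Lemma continuous_discreteP (f : P2 -> int) :
  continuous (f : P2 -> discrete_topology int) <->
  forall x, nbhs x [set y | f y = f x].
Proof.
split=> [cf x|cf x W Wfx]; first exact: (cf x [set f x] (discrete_set1 _)).
by apply: filterS (cf x) => y /= ->; exact: nbhs_singleton Wfx.
Qed.

Definition continuous_int : {pred P2 -> int} :=
  fun f => `[< continuous (f : P2 -> discrete_topology int) >].

Lemma continuous_intP (f : P2 -> int) :
  reflect (forall x, nbhs x [set y | f y = f x]) (f \in continuous_int).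
Proof. by apply: (iffP (asboolP _)); rewrite continuous_discreteP. Qed.

Lemma continuous_int_zmod_closed : zmod_closed continuous_int.
Proof.
split=> [|f g /continuous_intP cf /continuous_intP cg].
  by apply/continuous_intP => x; apply: filterS filterT.
apply/continuous_intP => x; apply: filterS2 (cf x) (cg x) => y /= fy gy.
by rewrite /GRing.add /GRing.opp /= fy gy.
Qed.

HB.instance Definition _ :=
  GRing.isZmodClosed.Build (P2 -> int) continuous_int
    continuous_int_zmod_closed.

Definition CP2 := {f : P2 -> int | f \in continuous_int}.

HB.instance Definition _ := Choice.on CP2.
HB.instance Definition _ := SubType.on CP2.
HB.instance Definition _ := [SubChoice_isSubZmodule of CP2 by <:].

Lemma CP2_act_subproof (g : PGL3 K) (f : CP2) :
  (fun x => val f (P2_act g^-1%g x)) \in continuous_int.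
Proof.
have /continuous_intP cf := valP f; apply/continuous_intP => x.
exact: (@P2_act_continuous g^-1%g x) (cf _).
Qed.

Definition CP2_act (g : PGL3 K) (f : CP2) : CP2 :=
  exist _ (fun x => val f (P2_act g^-1%g x)) (CP2_act_subproof g f).

Lemma CP2_one_subproof : (fun=> 1 : int) \in continuous_int.
Proof. by apply/continuous_intP => x; apply: filterS filterT. Qed.

Definition CP2_one : CP2 := exist _ (fun=> 1) CP2_one_subproof.

Definition coinvariant_submodule (Gamma : {pred PGL3 K}) : {pred CP2} :=
  fun f => `[< forall S : {pred CP2}, zmod_closed S ->
    {in Gamma & S, forall g f', CP2_act g f' \in S} ->
    {in Gamma, forall g f', CP2_act g f' - f' \in S} -> f \in S >].

Lemma coinvariant_submodule_zmod_closed (Gamma : {pred PGL3 K}) :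
  zmod_closed (coinvariant_submodule Gamma).
Proof.
split=> [|f g /asboolP Sf /asboolP Sg]; apply/asboolP => S Sz Sact Sgen.
  by have [] := Sz.
by have [_] := Sz; apply; [exact: Sf|exact: Sg].
Qed.

HB.instance Definition _ (Gamma : {pred PGL3 K}) :=
  GRing.isZmodClosed.Build CP2 (coinvariant_submodule Gamma)
    (coinvariant_submodule_zmod_closed Gamma).

Definition coinvariants (Gamma : {pred PGL3 K}) : zmodType :=
  Quotient.quot (coinvariant_submodule Gamma).

Definition coinvariant_class (Gamma : {pred PGL3 K}) (f : CP2) :
  coinvariants Gamma := \pi_(Quotient.quot (coinvariant_submodule Gamma)) f.

End ProjectivePlane.

Definition has_order (V : zmodType) (x : V) (n : nat) : Prop :=
  (0 < n)%N /\ forall m : nat, x *+ m = 0 <-> (n %| m)%N.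

(* A two-dimensional simplicial complex given by its chambers, together with
   a set of directed edges. *)
Record directed_complex := DirectedComplex {
  vertices :> Type;
  chamber : set (set vertices);
  directed_edge : vertices -> vertices -> Prop
}.

Definition simplex (X : directed_complex) (s : set X) : Prop :=
  s !=set0 /\ exists2 c, chamber c & s `<=` c.

Definition directed_isomorphism (X Y : directed_complex) (f : X -> Y) : Prop :=
  [/\ bijective f,
      forall s : set X, simplex s <-> simplex (f @` s) &
      forall a b : X, directed_edge a b -> directed_edge (f a) (f b)].

Section Building.
Variable K : nonarchLocalFieldType.

Definition is_lattice (L : set 'cV[K]_3) : Prop :=
  exists2 B : 'M[K]_3, B \in unitmx &
    L = [set B *m x | x in [set x : 'cV[K]_3 | forall i, integers (x i 0)]].

Definition scaled (a : K) (L : set 'cV[K]_3) : set 'cV[K]_3 :=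
  [set a *: x | x in L].

Definition lattice_class (L : set 'cV[K]_3) : set (set 'cV[K]_3) :=
  [set scaled a L | a in [set a : K | a != 0]].

Definition building_vertex :=
  {V : set (set 'cV[K]_3) |
    V \in [set lattice_class L | L in [set L | is_lattice L]]}.

Definition building_chamber (c : set building_vertex) : Prop :=
  exists L0 L1 L2 p,
    [/\ is_lattice L0, is_lattice L1, is_lattice L2 & uniformizer p] /\
    [/\ L0 `<` L1, L1 `<` L2, L2 `<` scaled p^-1 L0 &
      c = [set v | [\/ val v = lattice_class L0, val v = lattice_class L1
                     | val v = lattice_class L2]]].

Definition maximal_sublattice (L0 L1 : set 'cV[K]_3) : Prop :=
  L0 `<` L1 /\
  forall L, is_lattice L -> L0 `<=` L -> L `<=` L1 -> L = L0 \/ L = L1.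

Definition is_typing (t : building_vertex -> 'Z_3) : Prop :=
  forall L0 L1 p (v0 v1 : building_vertex),
    is_lattice L0 -> is_lattice L1 -> uniformizer p ->
    maximal_sublattice L0 L1 -> L1 `<=` scaled p^-1 L0 ->
    val v0 = lattice_class L0 -> val v1 = lattice_class L1 ->
    t v1 = t v0 + 1.

(* Typings of the building are unique up to an additive constant, so the choice
   of t is irrelevant. *)
Definition building_edge (u v : building_vertex) : Prop :=
  (exists2 c, building_chamber c & [set u; v] `<=` c) /\
  exists2 t, is_typing t & t v = t u + 1.

Definition building : directed_complex :=
  DirectedComplex building_chamber building_edge.

Lemma building_act_subproof (g : PGL3 K) (v : building_vertex) :
  [set mulmx (val (repr g)) @` L | L in val v] \in
    [set lattice_class L | L in [set L | is_lattice L]].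
Proof.
have /set_mem[L [B Bu ->] <-] := valP v; apply/mem_set.
set A := val (repr g); set O := [set x : 'cV[K]_3 | _].
exists (mulmx A @` (mulmx B @` O)).
  exists (A *m B); first by rewrite unitmx_mul (valP (repr g)).
  by rewrite image_comp; apply: eq_imagel => x _ /=; rewrite mulmxA.
apply/seteqP; split=> M.
  move=> [a a0 <-]; exists (scaled a (mulmx B @` O)); first by exists a.
  rewrite /scaled !image_comp; apply: eq_imagel => x _ /=.
  by rewrite -scalemxAr.
move=> [_ [a a0 <-] <-]; exists a => //.
rewrite /scaled !image_comp; apply: eq_imagel => x _ /=.
by rewrite -scalemxAr.
Qed.

(* Independent of the representative, since vertices are closed under
   scaling. *)
Definition building_act (g : PGL3 K) (v : building_vertex) : building_vertex :=
  exist _ [set mulmx (val (repr g)) @` L | L in val v]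
    (building_act_subproof g v).

Definition A2tilde_group (Gamma : {pred PGL3 K}) : Prop :=
  {in Gamma, forall g, forall v, building_act g v = v -> g = 1%g} /\
  forall u v, exists2 g, g \in Gamma & building_act g u = v.

End Building.

Section Presentation.
Variables (X : choiceType) (R : set (seq (bool * X))).

(* The letter (true, x) stands for x and (false, x) for its inverse. *)
Inductive word_equiv : seq (bool * X) -> seq (bool * X) -> Prop :=
| word_equiv_refl u : word_equiv u u
| word_equiv_sym u v : word_equiv u v -> word_equiv v u
| word_equiv_trans u v w : word_equiv u v -> word_equiv v w -> word_equiv u w
| word_equiv_cat u u' v v' :
    word_equiv u u' -> word_equiv v v' -> word_equiv (u ++ v) (u' ++ v')
| word_equiv_cancel b x : word_equiv [:: (b, x); (~~ b, x)] [::]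
| word_equiv_relator r : R r -> word_equiv r [::].

Definition word_equivb : rel (seq (bool * X)) :=
  fun u v => `[< word_equiv u v >].

Lemma word_equivb_equiv : equiv_class_of word_equivb.
Proof.
split=> [u|u v|v u w].
- by apply/asboolP; exact: word_equiv_refl.
- by apply: asbool_equiv_eq; split=> ?; exact: word_equiv_sym.
- move=> /asboolP uv /asboolP vw; apply/asboolP.
  exact: word_equiv_trans uv vw.
Qed.

Canonical word_equivb_equiv_rel := EquivRelPack word_equivb_equiv.

Definition presented_group := {eq_quot word_equivb}.

HB.instance Definition _ := EqQuotient.on presented_group.
HB.instance Definition _ := Choice.on presented_group.

Definition word_inv (u : seq (bool * X)) : seq (bool * X) :=
  rev [seq (~~ a.1, a.2) | a <- u].

Definition pres_one : presented_group := \pi_presented_group [::].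
Definition pres_mul (a b : presented_group) : presented_group :=
  \pi_presented_group (repr a ++ repr b).
Definition pres_inv (a : presented_group) : presented_group :=
  \pi_presented_group (word_inv (repr a)).

Lemma pres_eqP u v :
  reflect (word_equiv u v)
    (\pi_presented_group u == \pi_presented_group v).
Proof. by rewrite eqmodE; exact: asboolP. Qed.

Lemma pres_reprP u : word_equiv (repr (\pi_presented_group u)) u.
Proof. by apply/pres_eqP; rewrite reprK. Qed.

Lemma pres_mulE u v : pres_mul (\pi u) (\pi v) = \pi_presented_group (u ++ v).
Proof. by apply/eqP/pres_eqP/word_equiv_cat; exact: pres_reprP. Qed.

Lemma pres_mulA : associative pres_mul.
Proof.
elim/quotW=> u; elim/quotW=> v; elim/quotW=> w.
by rewrite !pres_mulE catA.
Qed.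
Lemma pres_mul1 : left_id pres_one pres_mul.
Proof. by elim/quotW=> u; rewrite pres_mulE. Qed.
Lemma pres_1mul : right_id pres_one pres_mul.
Proof. by elim/quotW=> u; rewrite pres_mulE cats0. Qed.

Lemma word_invK : involutive word_inv.
Proof.
move=> u; rewrite /word_inv map_rev revK -map_comp -[RHS]map_id.
by apply: eq_map => -[b x] /=; rewrite negbK.
Qed.

Lemma word_invr u : word_equiv (u ++ word_inv u) [::].
Proof.
elim: u => [|[b x] u IHu]; first exact: word_equiv_refl.
rewrite /word_inv map_cons rev_cons -cats1 -/(word_inv u) /= catA -cat1s.
apply: word_equiv_trans (word_equiv_cancel b x).
rewrite -[[:: (b, x); _]]cat1s; apply: word_equiv_cat (word_equiv_refl _) _.
rewrite -[X in word_equiv _ X]cat0s.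
exact: word_equiv_cat IHu (word_equiv_refl _).
Qed.

Lemma pres_Vmul : right_inverse pres_one pres_inv pres_mul.
Proof.
elim/quotW=> u; rewrite /pres_inv -{1}[\pi u]reprK pres_mulE.
by apply/eqP/pres_eqP; exact: word_invr.
Qed.
Lemma pres_mulV : left_inverse pres_one pres_inv pres_mul.
Proof.
elim/quotW=> u; rewrite /pres_inv -{2}[\pi u]reprK pres_mulE.
apply/eqP/pres_eqP; rewrite -{2}[repr _]word_invK; exact: word_invr.
Qed.

HB.instance Definition _ := isGroup.Build presented_group
  pres_mulA pres_mul1 pres_1mul pres_mulV pres_Vmul.

Definition pres_gen (x : X) : presented_group :=
  \pi_presented_group [:: (true, x)].

End Presentation.

(* All the definitions below assume that F has q ^ 3 elements. *)
Section TitsType.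
Variables (q : nat) (F : finFieldType).

(* F_q^* inside F^*, as the units fixed by the Frobenius u |-> u ^ q. *)
Definition subfield_units : {set {unit F}} :=
  [set u : {unit F} | (u ^+ q)%g == u]%SET.

Lemma subfield_units_group_set : group_set subfield_units.
Proof.
apply/group_setP; split=> [|u v]; first by rewrite inE expg1n.
rewrite !inE => /eqP uq /eqP vq.
have uv : commute u v by apply: val_inj; rewrite /= mulrC.
by rewrite expgMn // uq vq.
Qed.

Canonical subfield_units_group := Group subfield_units_group_set.

Definition tits_P := coset_of subfield_units.

Definition frob_trace (a : F) : F := a + a ^+ q + a ^+ (q ^ 2).

Definition trace_zero (xi : tits_P) : Prop :=
  exists2 u : {unit F}, coset subfield_units u = xi &
    frob_trace (FinRing.uval u) = 0.

Definition tits_triple (x y z : tits_P) : Prop :=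
  exists2 xi, trace_zero xi & y = (x * xi)%g /\ z = (x * xi ^+ q.+1)%g.

Definition tits_relator (r : seq (bool * tits_P)) : Prop :=
  exists x y z, tits_triple x y z /\ r = [:: (true, x); (true, y); (true, z)].

Definition tits_group := presented_group tits_relator.

HB.instance Definition _ := Group.on tits_group.

Definition tits_gen (x : tits_P) : tits_group := pres_gen tits_relator x.

Definition tits_chamber (c : set tits_group) : Prop :=
  exists (a : tits_group) x y z, tits_triple x y z /\
    c = [set a; a * tits_gen x; a * tits_gen x * tits_gen y]%g.

Definition tits_edge (a b : tits_group) : Prop :=
  exists x : tits_P, b = (a * tits_gen x)%g.

Definition tits_building : directed_complex :=
  DirectedComplex tits_chamber tits_edge.

Definition tits_type (K : nonarchLocalFieldType) (Gamma : {pred PGL3 K}) :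
    Prop :=
  exists (phi : {multiplicative tits_group -> PGL3 K})
         (Phi : tits_building -> building K),
    [/\ injective phi,
        forall g, g \in Gamma <-> exists a, phi a = g,
        directed_isomorphism Phi &
        forall a b : tits_group, Phi (a * b)%g = building_act (phi a) (Phi b)].

End TitsType.

(* Main.v *)
(** For lattices [L <= M] let [U(L, M)] be the set of points of the projective
    plane whose line meets [M] in more than [L].

    Let [e x] be the class of the indicator of [U(L, M)] in the coinvariants,
    where [[L]] and [[M]] are the vertices [1] and [x] of the building and [L]
    is maximal in [M]. In a chain [L0 < L1 < L2 < p^-1 L0] a line grows exactly
    once, so [e x + e y + e z = [1]] for every relator [xyz]. Every line grows
    towards exactly one neighbour [x] of [1], and in the step from [x^-1] to [1]
    for exactly [q^2] of the [x]; hence the sum of all [e x] is both [[1]] and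
    [q^2 [1]]. In the Tits case, summing the first relation over all [x] for a
    fixed [xi] gives [3 [1] = (q^2 + q + 1) [1]], so [(q - 1) [1] = 0].

    For the lower bound, modulo [q - 1] all lattices of [K^3] have the same Haar
    measure, so there is a GL_3(K)-invariant integral of locally constant
    functions on [K^3] with values in [Z/(q - 1)] that gives every lattice
    coset the mass 1. Integrating a function on the plane over the vectors with a
    normalized coordinate vector gives an invariant functional on the functions
    on the plane; its value at 1 is [q^2 + q + 1 = 3], which is a unit when [q]
    is not 1 modulo 3. *)

Require Import Defs.
From HB Require Import structures.
From mathcomp Require Import all_boot all_order all_fingroup all_algebra.
From mathcomp Require Import cyclic finfield generic_quotient.
From mathcomp Require Import all_classical all_reals topology.
From mathcomp Require Import zify ring.

Set Implicit Arguments.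
Unset Strict Implicit.
Unset Printing Implicit Defensive.

Import Order.TTheory GRing.Theory Num.Theory.

Local Open Scope classical_set_scope.
Local Open Scope ring_scope.

(** * The valuation ring *)

(** Inclusions of index q are the common atom. Up to a change of basis each one is [C *m Dx p]
    inside [C], so the independence of the integral from the period lattice comes down to one
    q-to-one map on K^3 / O^3, and q = 1 modulo q - 1. No measure is constructed: a locally constant
    function of bounded support is summed over the cosets of a period lattice. The Tits condition
    enters through the bijections x -> x xi and x -> x xi^(q+1) of the group P. Summing the triangle
    relation over all triples of an arbitrary triangle presentation would only give (q^2 - 1) [1] =
    0, which the two counts of neighbours already show; fixing one xi removes the factor q + 1. Two
    facts about the isomorphism of complexes have to be recovered: edges of the building come from
    generators, by comparing v(det) modulo 3, and distinct elements of P stay distinct in the group,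
    by counting the q^2 + q + 1 neighbours of a vertex. *)

Section ValuationRing.
Variable K : nonarchLocalFieldType.
Implicit Types x y : K.

(* [vz 0 = 0] is a junk value. *)
Definition vz x : int := if valuation x is n%:E%E then n else 0.

Lemma valuationE x : x != 0 -> valuation x = (vz x)%:E%E.
Proof.
rewrite -valuation_pinfty /vz => xN0; have := valuation_ninfty x.
by case: (valuation x) xN0.
Qed.

Lemma vzM x y : x != 0 -> y != 0 -> vz (x * y) = vz x + vz y.
Proof.
move=> x0 y0; have := valuationM x y.
by rewrite !valuationE ?mulf_neq0 // -EFinD => -[].
Qed.

Lemma vz1 : vz (1 : K) = 0.
Proof.
apply: (@addrI _ (vz (1 : K))).
by rewrite addr0 -vzM ?oner_neq0 // mulr1.
Qed.

Lemma vzV x : x != 0 -> vz x^-1 = - vz x.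
Proof.
by move=> x0; have := vzM x0 (invr_neq0 x0); rewrite mulfV // vz1; lia.
Qed.

Lemma vzN x : vz (- x) = vz x.
Proof.
have [->|x0] := eqVneq x 0; first by rewrite oppr0.
have N1 : (-1 : K) != 0 by rewrite oppr_eq0 oner_neq0.
have v1 : vz (-1 : K) = 0 by have := vzM N1 N1; rewrite mulrNN mulr1 vz1; lia.
by rewrite -mulN1r vzM // v1 add0r.
Qed.

Lemma vzXn x n : x != 0 -> vz (x ^+ n) = vz x *+ n.
Proof.
move=> x0; elim: n => [|n IHn]; first by rewrite vz1.
by rewrite exprS vzM ?expf_neq0 // IHn mulrS.
Qed.

Definition intg : {pred K} := fun x => (0 <= valuation x)%E.
Definition maxid : {pred K} := fun x => (0 < valuation x)%E.

Lemma intgE x : (x \in intg) = (x == 0) || (0 <= vz x).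
Proof.
rewrite unfold_in; have [->|x0] := eqVneq x 0; first by rewrite valuation0.
by rewrite valuationE // lee_fin.
Qed.

Lemma maxidE x : (x \in maxid) = (x == 0) || (0 < vz x).
Proof.
rewrite unfold_in; have [->|x0] := eqVneq x 0; first by rewrite valuation0.
by rewrite valuationE // lte_fin.
Qed.

Lemma valuationN x : valuation (- x) = valuation x.
Proof.
have [->|x0] := eqVneq x 0; first by rewrite oppr0.
by rewrite !valuationE ?oppr_eq0 // vzN.
Qed.

Lemma intg_subring_closed : subring_closed intg.
Proof.
split=> [|x y|x y].
- by rewrite intgE vz1 lexx orbT.
- rewrite !unfold_in => x0 y0; apply: le_trans (valuationD _ _).
  by rewrite valuationN le_min x0.
- by rewrite !unfold_in valuationM => x0 y0; rewrite adde_ge0.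
Qed.
HB.instance Definition _ := GRing.isSubringClosed.Build K intg
  intg_subring_closed.

Lemma maxid_zmod_closed : zmod_closed maxid.
Proof.
split=> [|x y]; first by rewrite maxidE eqxx.
rewrite !unfold_in => x0 y0; apply: lt_le_trans (valuationD _ _).
by rewrite valuationN lt_min x0.
Qed.
HB.instance Definition _ := GRing.isZmodClosed.Build K maxid
  maxid_zmod_closed.

Lemma maxid_intg x : x \in maxid -> x \in intg.
Proof. by rewrite !unfold_in => /ltW. Qed.

Lemma maxidMl x y : x \in intg -> y \in maxid -> x * y \in maxid.
Proof.
rewrite intgE !maxidE; have [->|x0] := eqVneq x 0; first by rewrite mul0r eqxx.
have [->|y0] := eqVneq y 0; first by rewrite mulr0 eqxx.
by rewrite vzM // mulf_eq0 (negbTE x0) (negbTE y0) /=; lia.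
Qed.

Lemma maxidMr x y : x \in maxid -> y \in intg -> x * y \in maxid.
Proof. by move=> *; rewrite mulrC maxidMl. Qed.

Lemma maxid1 : 1 \notin maxid.
Proof. by rewrite maxidE vz1 ltxx oner_eq0. Qed.

(** The units of the valuation ring. *)
Definition intgu x := (x \in intg) && (x \notin maxid).

Lemma intguE x : intgu x = (x != 0) && (vz x == 0).
Proof.
rewrite /intgu intgE maxidE; case: eqP => //= _; apply/idP/idP; lia.
Qed.

Lemma intguV x : intgu x -> intgu x^-1.
Proof.
rewrite !intguE => /andP[x0 /eqP vx]; rewrite invr_eq0 x0 vzV // vx.
by rewrite oppr0.
Qed.

Lemma intgu1 : intgu 1.
Proof. by rewrite /intgu rpred1 maxid1. Qed.

Lemma intgu_neq0 x : intgu x -> x != 0.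
Proof. by rewrite intguE => /andP[]. Qed.

Lemma intgu_intg x : intgu x -> x \in intg.
Proof. by case/andP. Qed.

Lemma intg_not_maxid x : x \in intg -> x \notin maxid -> intgu x.
Proof. by move=> *; apply/andP. Qed.

Lemma maxid_mulu x y : intgu x -> (x * y \in maxid) = (y \in maxid).
Proof.
move=> xu; apply/idP/idP; last by apply: maxidMl; exact: intgu_intg.
have := intgu_intg (intguV xu) => xi /(maxidMl xi).
by rewrite mulKf // intgu_neq0.
Qed.

Lemma maxid_congr x y : x - y \in maxid -> (x \in maxid) = (y \in maxid).
Proof.
move=> xy; apply/idP/idP => h; last by rewrite -(subrK y x) rpredD.
by rewrite -[y](subKr x) rpredB.
Qed.

Section Uniformizer.
Variables (p : K) (p_unif : uniformizer p).

Lemma uniformizer_neq0 : p != 0.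
Proof. by rewrite -valuation_pinfty p_unif. Qed.

Lemma vz_uniformizer : vz p = 1.
Proof. by rewrite /vz p_unif. Qed.

Lemma maxidP x : (x \in maxid) = (p^-1 * x \in intg).
Proof.
have p0 := uniformizer_neq0.
have [->|x0] := eqVneq x 0; first by rewrite mulr0 !rpred0.
rewrite maxidE intgE mulf_eq0 invr_eq0 (negbTE p0) (negbTE x0) /=.
by rewrite vzM ?invr_eq0 // vzV // vz_uniformizer; apply/idP/idP; lia.
Qed.

Lemma uniformizer_maxid : p \in maxid.
Proof. by rewrite maxidP mulVf ?uniformizer_neq0 // rpred1. Qed.

Lemma uniformizer_intg : p \in intg.
Proof. exact/maxid_intg/uniformizer_maxid. Qed.

End Uniformizer.

Lemma exists_uniformizer : exists p : K, uniformizer p.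
Proof. exact: valuation1. Qed.

(** The residue field is only given as a set of cosets of cardinality [q]; a transversal indexed by
    ['I_q] replaces it in all later counts. *)
Lemma residue_representatives q : (residue_field K #= `I_q)%card ->
  exists r : 'I_q -> K, [/\ forall a, r a \in intg,
    forall a b, r a - r b \in maxid -> a = b &
    forall x, x \in intg -> exists a, x - r a \in maxid].
Proof.
move=> Kq; pose cls (x : K) : set K := [set y | (0 < valuation (y - x)%R)%E].
have clsE x y : x - y \in maxid -> cls x = cls y.
  move=> xy; apply/seteqP; split=> z h.
    have : (z - x) + (x - y) \in maxid by rewrite rpredD.
    by rewrite addrA subrK.
  have : (z - y) - (x - y) \in maxid by rewrite rpredB.
  by rewrite opprB addrA subrK.
have cls_inj x y : cls x = cls y -> x - y \in maxid.
  move=> E; have : cls x x by rewrite /cls /= subrr valuation0.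
  by rewrite E.
have /card_set_bijP[f [fI finj fsurj]] := Kq.
have ex (a : 'I_q) : exists x, x \in intg /\ f (cls x) = a.
  by have [_ [x xi <-] fa] := fsurj a (ltn_ord a); exists x.
exists (fun a => projT1 (cid (ex a))); split=> [a|a b|x xi].
- by have [] := projT2 (cid (ex a)).
- case: cid => /= x [xi fx]; case: cid => /= y [yi fy] /clsE E.
  by apply: val_inj; rewrite /= -fx -fy E.
- have cx : residue_field K (cls x) by exists x.
  have lt := fI _ cx; exists (Ordinal lt); case: cid => /= y [yi fy].
  apply: cls_inj; apply: finj; rewrite ?inE //; by exists y.
Qed.

End ValuationRing.

(** * Integral matrices and GL_n over the valuation ring O *)

Section IntegralMatrices.
Variable K : nonarchLocalFieldType.
Local Notation intm := (mxOver (@intg K)).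
Local Notation maxm := (mxOver (@maxid K)).

Lemma det_intg n (A : 'M[K]_n) : A \is a intm -> \det A \in @intg K.
Proof.
move=> /mxOverP Ai; apply: rpred_sum => s _.
by rewrite rpredM ?rpredX ?rpredN ?rpred1 // rpred_prod.
Qed.

Lemma adj_intg n (A : 'M[K]_n) : A \is a intm -> \adj A \is a intm.
Proof.
move=> /mxOverP Ai; apply/mxOverP => i j; rewrite mxE /cofactor.
rewrite rpredM ?rpredX ?rpredN ?rpred1 //; apply: det_intg.
by apply/mxOverP => k l; rewrite !mxE.
Qed.

Lemma mxOver_tr (S : {pred K}) m n (A : 'M[K]_(m, n)) :
  A \is a mxOver S -> A^T \is a mxOver S.
Proof. by move=> /mxOverP AS; apply/mxOverP => i j; rewrite mxE. Qed.

Lemma maxm_intm m n (A : 'M[K]_(m, n)) : A \is a maxm -> A \is a intm.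
Proof. by apply: mxOverS => x; exact: maxid_intg. Qed.

Definition GLO n (G : 'M[K]_n) : Prop :=
  [/\ G \is a intm, G \in unitmx & invmx G \is a intm].

Lemma GLO_inv n (G : 'M[K]_n) : GLO G -> GLO (invmx G).
Proof. by case=> Gi Gu Vi; split; rewrite ?unitmx_inv ?invmxK. Qed.

Lemma GLO_tr n (G : 'M[K]_n) : GLO G -> GLO G^T.
Proof.
case=> Gi Gu Vi; split; rewrite ?unitmx_tr ?mxOver_tr //.
by rewrite -trmx_inv mxOver_tr.
Qed.

Lemma GLO_intro n (G H : 'M[K]_n) :
  G \is a intm -> H \is a intm -> G *m H = 1%:M -> GLO G.
Proof.
move=> Gi Hi GH; have [Gu Hu] := mulmx1_unit GH; split=> //.
by rewrite -[invmx G]mulmx1 -GH mulKmx.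
Qed.

Lemma GLO_mul n (G H : 'M[K]_n) : GLO G -> GLO H -> GLO (G *m H).
Proof.
move=> [Gi Gu Gv] [Hi Hu Hv]; apply: (@GLO_intro _ _ (invmx H *m invmx G)).
- by rewrite mxOverM.
- by rewrite mxOverM.
- by rewrite mulmxA mulmxK // mulmxV.
Qed.

Lemma GLO_det n (G : 'M[K]_n) : G \is a intm -> intgu (\det G) -> GLO G.
Proof.
move=> Gi du; apply: (@GLO_intro _ _ ((\det G)^-1 *: \adj G)) => //.
  by rewrite mxOverZ ?adj_intg // intgu_intg // intguV.
rewrite -scalemxAr mul_mx_adj scale_scalar_mx mulVf //.
exact: intgu_neq0.
Qed.

Lemma vz_det_GLO n (G : 'M[K]_n) : GLO G -> vz (\det G) = 0.
Proof.
case=> Gi Gu Vi; have d0 : \det G != 0 by rewrite -unitfE -unitmxE.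
have := det_intg Gi; have := det_intg Vi.
rewrite det_inv !intgE invr_eq0 (negbTE d0) vzV //= => le0 ge0.
by apply/eqP; rewrite eq_le ge0 -oppr_ge0 le0.
Qed.

Definition primitive n (v : 'cV[K]_n) : bool :=
  (v \is a intm) && [exists i, v i 0 \notin @maxid K].

Lemma primitiveE n (v : 'cV[K]_n) :
  primitive v = (v \is a intm) && (v \isn't a maxm).
Proof.
congr (_ && _); apply/existsP/negP => [[i vi] /mxOverP /(_ i 0)|vm].
  by rewrite (negbTE vi).
apply/existsP; move: vm; apply: contra_notT.
rewrite negb_exists => /forallP vm; apply/mxOverP => i j.
by rewrite (ord1 j); have := vm i; rewrite negbK.
Qed.

(** Divide by an entry of least valuation. *)
Lemma exists_scale m n (A : 'M[K]_(m, n)) : A != 0 ->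
  exists2 c : K, c != 0 & c *: A \is a intm /\ exists i j, c * A i j = 1.
Proof.
move=> A0; have [[i0 j0] /= nz0] : exists ij : 'I_m * 'I_n, A ij.1 ij.2 != 0.
  apply/existsP; apply: contraR A0; rewrite negb_exists => /forallP h.
  by apply/eqP/matrixP => i j; have := h (i, j); rewrite negbK mxE => /eqP.
case: (arg_minP (fun ij : 'I_m * 'I_n => vz (A ij.1 ij.2))
  (P := fun ij => A ij.1 ij.2 != 0) (i0 := (i0, j0)) nz0) => -[i j] /= nz h.
exists (A i j)^-1; first by rewrite invr_eq0.
split; last by exists i, j; rewrite mulVf.
apply/mxOverP => k l; rewrite mxE intgE mulf_eq0 invr_eq0 (negbTE nz) /=.
have [//|nz'] := eqVneq (A k l) 0.
by rewrite vzM ?invr_eq0 // vzV // addrC subr_ge0 (h (k, l)).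
Qed.

Local Notation e0 := (delta_mx 0 0 : 'cV[K]_3).

(** If the entry [v i 0] is a unit, the matrix 1 + (v - e_i) e_i^T has determinant [v i 0] and sends
    e_i to [v]; a transposition first brings e_0 to e_i. The inverse is the Sherman-Morrison formula
    for a rank-one perturbation of 1. *)
Lemma primitive_completion (v : 'cV[K]_3) : primitive v ->
  exists2 G : 'M[K]_3, GLO G & G *m e0 = v.
Proof.
case/andP=> vi /existsP[i vu].
pose a := v - delta_mx i 0; pose b : 'rV[K]_3 := delta_mx 0 i.
have ui : intgu (v i 0) by apply: intg_not_maxid => //; exact/mxOverP.
have delta_int m n k l : (delta_mx k l : 'M[K]_(m, n)) \is a intm.
  by apply/mxOverP => ? ?; rewrite mxE rpred_nat.
have int1 : (1%:M : 'M[K]_3) \is a intm by rewrite mxOver_scalar ?rpred0 ?rpred1.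
have ai : a \is a intm by rewrite /a rpredB ?delta_int.
have bi : b \is a intm by exact: delta_int.
have abi : a *m b \is a intm by exact: mxOverM.
have ba : b *m a = (v i 0 - 1)%:M.
  apply/matrixP => k l; rewrite !ord1 mulmxBr mxE -rowE mxE mul_delta_mx.
  by rewrite !mxE !eqxx.
have E : GLO (1%:M + a *m b).
  apply: (@GLO_intro _ _ (1%:M - (v i 0)^-1 *: (a *m b))).
  - by rewrite rpredD.
  - by rewrite rpredB // mxOverZ // intgu_intg // intguV.
  - have PP : (a *m b) *m (a *m b) = (v i 0 - 1) *: (a *m b).
      by rewrite -mulmxA (mulmxA b) ba mul_scalar_mx -scalemxAr.
    move: (a *m b) PP => P PP.
    rewrite mulmxBr mulmx1 -[X in _ - X]scalemxAr mulmxDl mul1mx PP.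
    rewrite -{2}[P]scale1r -scalerDl scalerA addrCA subrr addr0.
    by rewrite mulVf ?(intgu_neq0 ui) // scale1r addrK.
have P : GLO (tperm_mx i 0 : 'M[K]_3).
  apply: (@GLO_intro _ _ (tperm_mx i 0)).
  - by apply/mxOverP => k l; rewrite !mxE rpred_nat.
  - by apply/mxOverP => k l; rewrite !mxE rpred_nat.
  - by rewrite -perm_mxM tperm2 perm_mx1.
exists ((1%:M + a *m b) *m tperm_mx i 0); first exact: GLO_mul.
have -> : (1%:M + a *m b) *m tperm_mx i 0 *m e0 =
          (1%:M + a *m b) *m delta_mx i 0.
  rewrite -mulmxA; congr (_ *m _); apply/matrixP => k l; rewrite !ord1.
  rewrite -colE !mxE eqxx andbT; congr (_%:R).
  by rewrite -(inj_eq (@perm_inj _ (tperm i 0))) tpermK tpermR.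
rewrite mulmxDl mul1mx -mulmxA mul_delta_mx.
have -> : delta_mx 0 0 = 1%:M :> 'M[K]_1.
  by apply/matrixP => k l; rewrite !ord1 !mxE.
by rewrite mulmx1 addrC subrK.
Qed.

End IntegralMatrices.

(** * Lattices *)

Section Lattices.
Variables (K : nonarchLocalFieldType) (p : K).
Hypothesis p_unif : uniformizer p.
Local Notation intm := (mxOver (@intg K)).
Local Notation maxm := (mxOver (@maxid K)).
Local Notation e0 := (delta_mx 0 0 : 'cV[K]_3).
Local Notation p0 := (uniformizer_neq0 p_unif).

(** The matrix diag(c, 1, 1). For c = p it is the elementary step: [lat (C *m Dx p)] has index q in
    [lat C], and by [neighbourI] every sublattice of index q has this form. *)
Definition Dx (c : K) : 'M[K]_3 := diag_mx (\row_j if j == 0 then c else 1).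

Lemma det_Dx c : \det (Dx c) = c.
Proof.
rewrite det_diag big_ord_recl big1 ?mulr1 ?mxE // => i _.
by rewrite mxE.
Qed.

Lemma DxM n c (A : 'M[K]_(3, n)) i j :
  (Dx c *m A) i j = (if i == 0 then c else 1) * A i j.
Proof. by rewrite mul_diag_mx !mxE. Qed.

Lemma Dx_mul c d : Dx c *m Dx d = Dx (c * d).
Proof.
apply/matrixP => i j; rewrite DxM !mxE; case: eqP => _; case: eqP => // _;
  by rewrite ?mulr1 ?mulr0.
Qed.

Lemma Dx1 : Dx 1 = 1%:M.
Proof. by apply/matrixP => i j; rewrite !mxE if_same. Qed.

Lemma Dx_unitmx c : c != 0 -> Dx c \in unitmx.
Proof. by move=> c0; rewrite unitmxE det_Dx unitfE. Qed.

Lemma Dx_intm c : c \in @intg K -> Dx c \is a intm.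
Proof.
move=> ci; apply/mxOverP => i j; rewrite !mxE.
by rewrite rpredMn //; case: ifP; rewrite ?rpred1.
Qed.

(* A row of [X^-1], scaled to be primitive, reduces to a functional that kills
   the image of [X] in the residue field. *)
Lemma smith_step (X : 'M[K]_3) :
  X \is a intm -> X \in unitmx -> 0 < vz (\det X) ->
  exists G X', [/\ GLO G, X' \is a intm & X = G *m Dx p *m X'].
Proof.
move=> Xi Xu dX.
have dX0 : \det X != 0 by rewrite -unitfE -unitmxE.
have V0 : invmx X != 0.
  by apply: contraTneq Xu => V0; rewrite -unitmx_inv V0 unitmxE det0 unitr0.
have [c c0 [cVi [i [j cij]]]] := exists_scale V0.
(* Taking determinants, integrality of [c *: invmx X] gives 3 v(c) >= v(det X) > 0. *)
have cm : c \in @maxid K.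
  have := det_intg cVi; rewrite detZ det_inv intgE maxidE (negbTE c0) /=.
  rewrite mulf_eq0 expf_eq0 invr_eq0 (negbTE c0) (negbTE dX0) /=.
  rewrite vzM ?expf_neq0 ?invr_eq0 // vzXn // vzV // subr_ge0 => le3.
  by rewrite -(pmulrn_lgt0 _ (isT : (0 < 3)%N)) (lt_le_trans dX).
pose w := (row i (c *: invmx X))^T.
have wprim : primitive w.
  apply/andP; split.
    by apply/mxOverP => k l; rewrite !mxE; have /mxOverP/(_ i k) := cVi; rewrite mxE.
  by apply/existsP; exists j; rewrite !mxE cij maxid1.
have [G0 G0O G0e] := primitive_completion wprim.
have HO := GLO_tr G0O; have [Hi Hu Vi] := HO.
(* The first row of [G0^T] is [w^T], so the first row of [G0^T *m X] is [c] times a row of the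
   identity, hence divisible by p. *)
exists (invmx G0^T), (Dx p^-1 *m (G0^T *m X)); split.
- exact: GLO_inv.
- apply/mxOverP => k l; rewrite DxM; case: eqP => [->|_]; last first.
    by rewrite mul1r; have /mxOverP := mxOverM Hi Xi; apply.
  rewrite -maxidP //.
  have -> : (G0^T *m X) 0 l = (w^T *m X) 0 l.
    by rewrite -G0e trmx_mul trmx_delta -mulmxA -rowE [RHS]mxE.
  rewrite trmxK -row_mul -scalemxAl mulVmx // !mxE.
  by rewrite mulr_natr rpredMn.
- rewrite -!mulmxA (mulmxA (Dx p)) Dx_mul mulfV ?p0 // Dx1 mul1mx mulKmx //.
Qed.

Definition lat (B : 'M[K]_3) : set 'cV[K]_3 :=
  [set B *m x | x in [set x : 'cV[K]_3 | forall i, integers (x i 0)]].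

Lemma latP B y : B \in unitmx -> lat B y <-> invmx B *m y \is a intm.
Proof.
move=> Bu; split=> [[x xi <-]|/mxOverP yi].
  by rewrite mulKmx //; apply/mxOverP => i j; rewrite ord1; exact: xi.
by exists (invmx B *m y); rewrite ?mulKVmx // => i; exact: yi.
Qed.

Lemma lat_mul B x : x \is a intm -> lat B (B *m x).
Proof. by move=> /mxOverP xi; exists x => // i; exact: xi. Qed.

Lemma lat_sub B C : B \in unitmx -> C \in unitmx ->
  lat B `<=` lat C <-> invmx C *m B \is a intm.
Proof.
move=> Bu Cu; split=> [BC|CBi].
  apply/mxOverP => i j.
  have : lat C (B *m delta_mx j 0).
    apply/BC/lat_mul/mxOverP => k l; rewrite mxE; exact: rpred_nat.
  by move/(latP _ Cu); rewrite mulmxA -colE => /mxOverP/(_ i 0); rewrite mxE.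
move=> _ [x xi <-]; apply/(latP _ Cu); rewrite mulmxA mxOverM //.
by apply/mxOverP => i j; rewrite ord1; exact: xi.
Qed.

Lemma lat_GLO B G : B \in unitmx -> GLO G -> lat (B *m G) = lat B.
Proof.
move=> Bu [Gi Gu Vi]; have BGu : B *m G \in unitmx by rewrite unitmx_mul Bu.
apply/seteqP; split; apply/lat_sub => //; first by rewrite mulKmx.
suff -> : invmx (B *m G) *m B = invmx G by [].
by rewrite -{2}(mulmxK Gu B) mulKmx.
Qed.

Lemma det_neq0 n (B : 'M[K]_n) : B \in unitmx -> \det B != 0.
Proof. by rewrite unitmxE unitfE. Qed.

Lemma vz_detM n (B C : 'M[K]_n) : B \in unitmx -> C \in unitmx ->
  vz (\det (B *m C)) = vz (\det B) + vz (\det C).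
Proof. by move=> Bu Cu; rewrite det_mulmx vzM ?det_neq0. Qed.

Lemma vz_det_intm n (C : 'M[K]_n) : C \in unitmx -> C \is a intm ->
  0 <= vz (\det C).
Proof.
by move=> Cu /det_intg; rewrite intgE (negbTE (det_neq0 Cu)).
Qed.

Lemma GLO_vz n (C : 'M[K]_n) : C \in unitmx -> C \is a intm ->
  vz (\det C) = 0 -> GLO C.
Proof.
by move=> Cu Ci d0; apply: GLO_det => //; rewrite intguE det_neq0 //= d0.
Qed.

Lemma lat_subE B C : B \in unitmx -> C \in unitmx -> lat B `<=` lat C ->
  exists2 X, X \is a intm & B = C *m X.
Proof.
move=> Bu Cu /lat_sub => /(_ Bu Cu) Xi; exists (invmx C *m B) => //.
by rewrite mulKVmx.
Qed.

Lemma lat_sub_vz B C : B \in unitmx -> C \in unitmx -> lat B `<=` lat C ->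
  vz (\det C) <= vz (\det B).
Proof.
move=> Bu Cu /(lat_subE Bu Cu)[X Xi BE].
have Xu : X \in unitmx by move: Bu; rewrite BE unitmx_mul => /andP[].
by rewrite BE vz_detM // lerDl vz_det_intm.
Qed.

Lemma lat_sub_eq B C : B \in unitmx -> C \in unitmx -> lat B `<=` lat C ->
  vz (\det B) = vz (\det C) -> lat B = lat C.
Proof.
move=> Bu Cu /(lat_subE Bu Cu)[X Xi BE].
have Xu : X \in unitmx by move: Bu; rewrite BE unitmx_mul => /andP[].
rewrite BE vz_detM // -[RHS]addr0 => /addrI/(GLO_vz Xu Xi) XO.
exact: lat_GLO.
Qed.

Lemma lat_eq_vz B C : B \in unitmx -> C \in unitmx -> lat B = lat C ->
  vz (\det B) = vz (\det C).
Proof.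
move=> Bu Cu E; apply/eqP.
by rewrite eq_le !lat_sub_vz // E.
Qed.

Lemma scaled_lat a B : scaled a (lat B) = lat (a *: B).
Proof.
apply/seteqP; split=> y.
  by move=> [_ [x xi <-] <-]; exists x; rewrite // scalemxAl.
move=> [x xi <-]; exists (B *m x); first by exists x.
by rewrite scalemxAl.
Qed.

Lemma vz_detZ a (B : 'M[K]_3) : a != 0 -> B \in unitmx ->
  vz (\det (a *: B)) = vz a *+ 3 + vz (\det B).
Proof.
by move=> a0 Bu; rewrite detZ vzM ?expf_neq0 ?det_neq0 // vzXn.
Qed.

Lemma unitmx_scale a (B : 'M[K]_3) : a != 0 -> B \in unitmx -> a *: B \in unitmx.
Proof. by move=> a0 Bu; rewrite unitmxZ // unitfE. Qed.

Lemma lat_unitZ u B : intgu u -> B \in unitmx -> lat (u *: B) = lat B.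
Proof.
move=> uu Bu; have u0 := intgu_neq0 uu.
have uBu : u *: B \in unitmx by apply: unitmx_scale.
apply: lat_sub_eq => //.
  apply/lat_sub => //; rewrite -scalemxAr mulVmx // mxOverZ ?mxOver_scalar //.
  - exact: intgu_intg.
  - exact: rpred0.
  - exact: rpred1.
by rewrite vz_detZ //; move: uu; rewrite intguE u0 => /eqP ->; rewrite mul0rn add0r.
Qed.

Definition neighbour (L M : set 'cV[K]_3) : Prop :=
  exists2 C, C \in unitmx & L = lat (C *m Dx p) /\ M = lat C.

(** The transition matrix has determinant of valuation 1, so what remains after [smith_step] splits
    off one factor [Dx p] lies in GL_3(O). *)
Lemma neighbourI B C : B \in unitmx -> C \in unitmx -> lat B `<=` lat C ->
  vz (\det B) = vz (\det C) + 1 -> neighbour (lat B) (lat C).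
Proof.
move=> Bu Cu /(lat_subE Bu Cu)[X Xi BE].
have Xu : X \in unitmx by move: Bu; rewrite BE unitmx_mul => /andP[].
rewrite BE vz_detM // => /addrI dX.
have [|G [X' [GO X'i XE]]] := smith_step Xi Xu; first by rewrite dX.
have [_ Gu _] := GO; have Du := Dx_unitmx p0.
have X'u : X' \in unitmx by move: Xu; rewrite XE unitmx_mul => /andP[].
have X'O : GLO X'.
  apply: GLO_vz => //; move: dX; rewrite XE !vz_detM ?unitmx_mul ?Gu //.
  rewrite det_Dx (vz_uniformizer p_unif) vz_det_GLO // add0r -[RHS]addr0.
  exact: addrI.
exists (C *m G); first by rewrite unitmx_mul Cu.
split; last by rewrite lat_GLO.
by rewrite XE !mulmxA lat_GLO // !unitmx_mul Cu Gu.
Qed.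

Lemma neighbour_sub L M : neighbour L M -> L `<=` M.
Proof.
move=> [C Cu [-> ->]]; apply/lat_sub => //.
  by rewrite unitmx_mul Cu Dx_unitmx ?p0.
by rewrite mulKmx // Dx_intm // uniformizer_intg.
Qed.

End Lattices.

(** * The projective plane over the residue field *)

Section NormalizedVectors.
Variables (K : nonarchLocalFieldType) (q : nat) (r : 'I_q -> K).
Hypothesis r_intg : forall a, r a \in @intg K.
Hypothesis r_inj : forall a b, r a - r b \in @maxid K -> a = b.
Hypothesis r_surj : forall x, x \in @intg K -> exists a, x - r a \in @maxid K.
Local Notation intm := (mxOver (@intg K)).
Local Notation maxm := (mxOver (@maxid K)).

(* The points of the projective plane over the residue field, as the vectors
   (1, a, b), (0, 1, a), (0, 0, 1) modulo the maximal ideal. *)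
Definition point_index : finType := ('I_q * 'I_q + 'I_q + unit)%type.

Definition point_entry (w : point_index) (i : nat) : K :=
  match w, i with
  | inl (inl _), 0 => 1
  | inl (inl (a, _)), 1 => r a
  | inl (inl (_, b)), _ => r b
  | inl (inr _), 0 => 0
  | inl (inr _), 1 => 1
  | inl (inr a), _ => r a
  | inr _, 2 => 1
  | inr _, _ => 0
  end.

Definition point_vec (w : point_index) : 'cV[K]_3 := \col_i point_entry w i.

Lemma card_point_index : #|point_index| = (q ^ 2 + q + 1)%N.
Proof. by rewrite !card_sum card_prod card_ord card_unit. Qed.

Lemma point_vec_intm w : point_vec w \is a intm.
Proof.
apply/mxOverP => i j; rewrite mxE; case: w i => [[[a b]|a]|[]] [[|[|[|//]]] ?] //=;
  by rewrite ?rpred0 ?rpred1.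
Qed.

Lemma forall_I3 (P : 'I_3 -> Prop) :
  P (inord 0) -> P (inord 1) -> P (inord 2) -> forall i, P i.
Proof.
move=> P0 P1 P2 i; rewrite -(inord_val i).
by case: i => [[|[|[|//]]]].
Qed.

(** Divide by the first coordinate that is a unit; the coordinates before it vanish modulo the
    maximal ideal. *)
Lemma point_vec_normalized v : primitive v ->
  exists c w, intgu c /\ c *: v - point_vec w \is a maxm.
Proof.
move=> /andP[/mxOverP vi /existsP[i vu]].
have unit_i k : v k 0 \notin @maxid K -> intgu (v k 0).
  by move=> ?; apply: intg_not_maxid.
have maxmP (w : point_index) (c : K) :
    c * v (inord 0) 0 - point_entry w 0 \in @maxid K ->
    c * v (inord 1) 0 - point_entry w 1 \in @maxid K ->
    c * v (inord 2) 0 - point_entry w 2 \in @maxid K ->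
    c *: v - point_vec w \is a maxm.
  move=> h0 h1 h2; apply/mxOverP => k l; rewrite !mxE (ord1 l).
  by elim/forall_I3: k; rewrite inordK.
have [v0|/unit_i v0] := boolP (v (inord 0) 0 \in @maxid K); last first.
  have v0V := intgu_intg (intguV v0); have v00 := intgu_neq0 v0.
  have [a ha] := r_surj (rpredM v0V (vi (inord 1) 0)).
  have [b hb] := r_surj (rpredM v0V (vi (inord 2) 0)).
  exists (v (inord 0) 0)^-1, (inl (inl (a, b))); split; first exact: intguV.
  by apply: maxmP => //=; rewrite mulVf // subrr rpred0.
have [v1|/unit_i v1] := boolP (v (inord 1) 0 \in @maxid K); last first.
  have v1V := intgu_intg (intguV v1); have v10 := intgu_neq0 v1.
  have [a ha] := r_surj (rpredM v1V (vi (inord 2) 0)).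
  exists (v (inord 1) 0)^-1, (inl (inr a)); split; first exact: intguV.
  apply: maxmP => //=; first by rewrite subr0 maxidMl.
  by rewrite mulVf // subrr rpred0.
have v2 : intgu (v (inord 2) 0).
  by apply: unit_i; elim/forall_I3: i vu; rewrite ?v0 ?v1.
have v2V := intgu_intg (intguV v2); have v20 := intgu_neq0 v2.
exists (v (inord 2) 0)^-1, (inr tt); split; first exact: intguV.
apply: maxmP => /=; rewrite ?subr0 ?maxidMl //.
by rewrite mulVf // subrr rpred0.
Qed.

(** The conclusion on [c] is what makes the normalized multiples of a vector a single orbit of 1 +
    m, where m is the maximal ideal. *)
Lemma point_vec_inj c w w' : intgu c ->
  c *: point_vec w - point_vec w' \is a maxm -> w = w' /\ c - 1 \in @maxid K.
Proof.
move=> cu /mxOverP h.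
have E (i : nat) : (i < 3)%N ->
    c * point_entry w i - point_entry w' i \in @maxid K.
  by move=> i3; have := h (inord i) 0; rewrite !mxE inordK.
have [_ cm] := andP cu.
have n1 := maxid1 K; have := (E 0 isT, E 1 isT, E 2 isT).
have c1 a b : c - 1 \in @maxid K -> c * r a - r b \in @maxid K -> a = b.
  move=> c1m h1; apply: r_inj; rewrite -(subrKA (c * r a)) rpredD //.
  by rewrite -opprB -{2}[r a]mul1r -mulrBl rpredN maxidMr.
have nN1 : - 1 \notin @maxid K by rewrite rpredN.
case: w w' {E h} => [[[a b]|a]|[]] [[[a' b']|a']|[]] /=;
  rewrite ?mulr1 ?mulr0 ?subr0 ?sub0r ?(negbTE n1) ?(negbTE nN1) ?(negbTE cm);
  case=> -[] //.
- by move=> h1 /(c1 _ _ h1) -> /(c1 _ _ h1) ->.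
- by move=> _ h1 /(c1 _ _ h1) ->.
Qed.

Lemma point_vec_primitive w : primitive (point_vec w).
Proof.
rewrite primitiveE point_vec_intm; apply/negP => /mxOverP h.
case: w h => [[[a b]|a]|[]] h.
- by have := h (inord 0) 0; rewrite mxE inordK //= (negbTE (maxid1 K)).
- by have := h (inord 1) 0; rewrite mxE inordK //= (negbTE (maxid1 K)).
- by have := h (inord 2) 0; rewrite mxE inordK //= (negbTE (maxid1 K)).
Qed.

End NormalizedVectors.

(** * The integral modulo q - 1 *)

Lemma addr_eq_subr (U : zmodType) (x s y t : U) : x + s = y + t -> x - y = t - s.
Proof. by move=> E; rewrite -[x](addrK s) E addrAC (addrC y) addrK. Qed.

Section CosetSums.
Variables (K : nonarchLocalFieldType) (p : K).
Hypothesis p_unif : uniformizer p.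
Variables (q : nat) (r : 'I_q -> K).
Hypothesis r_intg : forall a, r a \in @intg K.
Hypothesis r_inj : forall a b, r a - r b \in @maxid K -> a = b.
Hypothesis r_surj : forall x, x \in @intg K -> exists a, x - r a \in @maxid K.
Variable A : nzRingType.
Hypothesis qA : q%:R = 1 :> A.
Local Notation intm := (mxOver (@intg K)).
Local Notation maxm := (mxOver (@maxid K)).
Local Notation V := 'cV[K]_3.
Local Notation p0 := (uniformizer_neq0 p_unif).
Local Notation D := (Dx p).

(** A chosen element of x + O^3, so that sums over K^3 / O^3 become sums over a set of vectors
    instead of a quotient type. *)
Definition coset_rep (x : V) : V := xget 0 [set y : V | y - x \is a intm].
Definition coset_reps : set V := range coset_rep.
Local Notation T := coset_reps.

Lemma coset_repP x : coset_rep x - x \is a intm.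
Proof.
by rewrite /coset_rep; apply: (@xgetPex _ 0 [set y | y - x \is a intm]);
  exists x; rewrite /= subrr rpred0.
Qed.

Lemma coset_rep_eq x y : x - y \is a intm -> coset_rep x = coset_rep y.
Proof.
move=> xy; rewrite /coset_rep; congr xget; apply/seteqP; split=> z /= h.
  by rewrite -(subrK x z) -addrA rpredD.
by rewrite -(subrK y z) -addrA rpredD // -opprB rpredN.
Qed.

Lemma coset_repK x : coset_rep (coset_rep x) = coset_rep x.
Proof. exact/coset_rep_eq/coset_repP. Qed.

Lemma coset_reps_rep x : T (coset_rep x).
Proof. by exists x. Qed.

Lemma coset_reps_id x : T x -> coset_rep x = x.
Proof. by move=> [y _ <-]; rewrite coset_repK. Qed.

Lemma coset_reps_inj x y : T x -> T y -> x - y \is a intm -> x = y.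
Proof.
by move=> /coset_reps_id xE /coset_reps_id yE /coset_rep_eq; rewrite xE yE.
Qed.

Definition bounded_by n : set V := [set x | p ^+ n *: x \is a intm].

(** A representative x at level n + 1 is determined by the representative t of p x, which is at
    level n, and by the residues of the three coordinates of p x - t. *)
Lemma finite_coset_reps n : finite_set (T `&` bounded_by n).
Proof.
elim: n => [|n IHn].
  apply: (@sub_finite_set _ _ [set coset_rep 0]); last exact: finite_set1.
  move=> x [Tx]; rewrite /bounded_by /= scale1r => xi.
  by rewrite -[LHS](coset_reps_id Tx); apply: coset_rep_eq; rewrite subr0.
pose f (ta : V * {ffun 'I_3 -> 'I_q}) :=
  coset_rep (p^-1 *: (ta.1 + \col_i r (ta.2 i))).
apply: (@sub_finite_set _ _
  (f @` ((T `&` bounded_by n) `*` [set: {ffun 'I_3 -> 'I_q}]))); last first.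
  by apply/finite_image/finite_setX => //; exact: finite_finset.
move=> x [Tx]; rewrite /bounded_by /= => xb.
have xr := coset_repP (p *: x); set t := coset_rep _ in xr.
have di : p *: x - t \is a intm by rewrite -opprB rpredN.
have /choice[a ha] (i : 'I_3) : exists a, p * x i 0 - t i 0 - r a \in @maxid K.
  by apply: r_surj; move/mxOverP/(_ i 0): di; rewrite !mxE.
exists (t, finfun a) => /=.
  split=> //; split; first exact: coset_reps_rep.
  rewrite -(subrK (p *: x) t) scalerDr rpredD //.
    by rewrite mxOverZ // rpredX // (uniformizer_intg p_unif).
  by rewrite scalerA -exprSr.
rewrite /f /= -[RHS](coset_reps_id Tx); apply: coset_rep_eq.
rewrite -opprB rpredN; apply/mxOverP => i j; rewrite (ord1 j).
have := ha i; rewrite (maxidP p_unif) !mxE ffunE.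
by rewrite 2!mulrBr mulKf ?p0 // mulrDr opprD addrA.
Qed.

Definition bounded (h : V -> A) : Prop :=
  exists n, forall x, h x != 0 -> bounded_by n x.

Definition periodic (B : 'M[K]_3) (h : V -> A) : Prop :=
  forall x y, y \is a intm -> h (x + B *m y) = h x.

(** Meant for an O^3-periodic [h], as a sum over K^3 / O^3. A bounded [h] has finite support on
    [coset_reps]; an infinite support would give the default value 0. *)
Definition coset_sum (h : V -> A) : A := \sum_(x \in T) h x.

Lemma bounded_byS m n x : (m <= n)%N -> bounded_by m x -> bounded_by n x.
Proof.
move=> mn; rewrite /bounded_by /= -(subnK mn) exprD -scalerA => xi.
by rewrite mxOverZ // rpredX // (uniformizer_intg p_unif).
Qed.

Lemma coset_sumE n h : (forall x, h x != 0 -> bounded_by n x) ->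
  coset_sum h = \sum_(x \in T `&` bounded_by n) h x.
Proof.
move=> hn; apply/esym/fsbig_widen; first by move=> x [].
move=> x [Tx nTx]; apply: contrapT => /eqP /hn xn; apply: nTx; split=> //.
Qed.

Lemma coset_sumD h1 h2 : bounded h1 -> bounded h2 ->
  coset_sum (h1 \+ h2) = coset_sum h1 + coset_sum h2.
Proof.
move=> [n1 b1] [n2 b2]; pose n := maxn n1 n2.
have {}b1 x : h1 x != 0 -> bounded_by n x.
  by move=> /b1; apply: bounded_byS; exact: leq_maxl.
have {}b2 x : h2 x != 0 -> bounded_by n x.
  by move=> /b2; apply: bounded_byS; exact: leq_maxr.
rewrite !(@coset_sumE n) //.
  by rewrite -fsbig_split //; exact: finite_coset_reps.
move=> x /=; have [E|/b1 //] := eqVneq (h1 x) 0.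
by rewrite E add0r => /b2.
Qed.

Lemma periodic_rep h x : periodic 1%:M h -> h (coset_rep x) = h x.
Proof.
move=> ph; rewrite -[in RHS](subrK (coset_rep x) x) addrC.
rewrite -[x - _]mul1mx ph //.
by rewrite -opprB rpredN coset_repP.
Qed.

Lemma coset_sum_GLO h G : GLO G -> periodic 1%:M h ->
  coset_sum (fun x => h (G *m x)) = coset_sum h.
Proof.
move=> [Gi Gu Vi] ph; rewrite /coset_sum.
rewrite [RHS](reindex_fsbig (fun x => coset_rep (G *m x)) T).
  by apply: eq_fsbigr => x _; rewrite periodic_rep.
split=> [x _|x y /set_mem Tx /set_mem Ty E|y Ty].
- exact: coset_reps_rep.
- apply: (coset_reps_inj Tx Ty); rewrite -(mulKmx Gu (x - y)).
  apply: mxOverM => //.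
  have -> : G *m (x - y) =
      (coset_rep (G *m y) - G *m y) - (coset_rep (G *m x) - G *m x).
    by rewrite mulmxBr E opprB [RHS]addrC addrA subrK.
  by apply: rpredB; exact: coset_repP.
- exists (coset_rep (invmx G *m y)); first exact: coset_reps_rep.
  rewrite -[RHS](coset_reps_id Ty); apply: coset_rep_eq.
  rewrite -{2}(mulKVmx Gu y) -mulmxBr mxOverM //; exact: coset_repP.
Qed.

(* Multiplication by [D] is [q]-to-one and onto on the cosets of O^3. *)
Lemma coset_sum_Dx h : bounded h -> periodic 1%:M h ->
  coset_sum (fun x => h (D *m x)) = coset_sum h.
Proof.
move=> [n hn] ph.
have DV x : D *m (Dx p^-1 *m x) = x.
  by rewrite mulmxA Dx_mul mulfV ?p0 // Dx1 mul1mx.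
have Di := Dx_intm (uniformizer_intg p_unif).
pose e := (delta_mx 0 0 : V).
have ei c : c \in @intg K -> c *: e \is a intm.
  by move=> ci; rewrite mxOverZ //; apply/mxOverP => i j; rewrite mxE rpred_nat.
(* [b (a, y)] represents the class of D^-1 (y + r a e): as [a] varies, these are the q cosets that
   [D] maps to the coset of y. *)
have /choice[b bP] (ay : 'I_q * V) : exists x, T x /\
    exists2 z, z \is a intm & D *m x = ay.2 + (r ay.1 *: e + D *m z).
  pose u := Dx p^-1 *m (ay.2 + r ay.1 *: e).
  exists (coset_rep u); split; first exact: coset_reps_rep.
  exists (coset_rep u - u); first exact: coset_repP.
  by rewrite mulmxBr [D *m u]DV [RHS]addrA [RHS]addrC subrK.
(* Each fibre contributes q equal terms, and q = 1 in [A]. *)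
have sum_ord (S : A) : \sum_(a \in [set: 'I_q]) S = S.
  have -> : [set: 'I_q] = [set` enum 'I_q].
    by apply/seteqP; split=> // a _; rewrite /= mem_enum.
  rewrite -fsbig_seq ?enum_uniq // big_const_seq count_predT -cardE card_ord.
  by rewrite iter_addr_0 -mulr_natl qA mul1r.
rewrite /coset_sum (reindex_fsbig b ([set: 'I_q] `*` T)).
  rewrite (_ : (\sum_(x \in _) _) = \sum_(ay \in [set: 'I_q] `*` T) h ay.2).
    rewrite -(fsbig_widen ([set: 'I_q] `*` (T `&` bounded_by n))); first last.
    - move=> [a y] [[_ /= Ty]] nTy; apply: contrapT => /eqP /hn yn; apply: nTy.
      by split.
    - by move=> [a y] [_ []].
    rewrite -(@pair_fsbig _ _ _ _ _ _ _ (fun _ => h)) //.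
    - by rewrite sum_ord -coset_sumE.
    - exact: finite_finset.
    - exact: finite_coset_reps.
  apply: eq_fsbigr => ay _; have [_ [z zi ->]] := bP ay.
  rewrite -[X in _ + X]mul1mx ph //; apply: rpredD; first exact: ei.
  exact: mxOverM.
have s00 c (x : V) : (c *: e + D *m x) 0 0 = c + p * x 0 0.
  by rewrite mxE DxM [X in X + _]mxE mxE !eqxx mulr1.
split=> [ay _|[a y] [a' y'] /set_mem[_ /= Ty] /set_mem[_ /= Ty'] E|x Tx].
- by have [] := bP ay.
- have [_ [z zi]] := bP (a, y); rewrite E.
  have [_ [z' zi' ->]] := bP (a', y'); rewrite /= => E3.
  have yE : y' = y.
    apply: (coset_reps_inj Ty' Ty); rewrite (addr_eq_subr E3).
    by apply: rpredB; apply: rpredD; rewrite ?ei // mxOverM.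
  move: E3; rewrite yE => /addrI/(congr1 (fun m : V => m 0 0)).
  rewrite !s00 => /addr_eq_subr E0; congr (_, _); apply/esym/r_inj.
  rewrite E0 -mulrBr; apply: maxidMr; first exact: uniformizer_maxid.
  by apply: rpredB; apply/mxOverP.
- have yi := coset_repP (D *m x); set y := coset_rep _ in yi.
  have mi : D *m x - y \is a intm by rewrite -opprB rpredN.
  have [|a ha] := r_surj (x := (D *m x - y) 0 0); first exact/mxOverP.
  exists (a, y); first by split=> //; exact: coset_reps_rep.
  have [Tb [z zi bE]] := bP (a, y); apply: (coset_reps_inj Tb Tx).
  pose z' := Dx p^-1 *m (D *m x - y - r a *: e).
  have -> : b (a, y) - x = z - z'.
    have Du : D \in unitmx by apply: Dx_unitmx; exact: p0.
    have Dinj : injective (mulmx D : V -> V) by exact: can_inj (mulKmx Du).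
    apply: Dinj; rewrite !mulmxBr bE /z' DV /=.
    rewrite !opprB [RHS]addrCA (addrC y) -!addrA.
    by [].
  rewrite rpredB //; apply/mxOverP => i j; rewrite (ord1 j) DxM.
  have -> : (D *m x - y - r a *: e) i 0 = (D *m x - y) i 0 - r a * (i == 0)%:R.
    by move: (D *m x - y) => m; rewrite !mxE andbT.
  case: eqP => [->|_]; first by rewrite -maxidP // mulr1.
  by rewrite mul1r mulr0 subr0; exact/mxOverP.
Qed.

End CosetSums.

(** * The integral and its invariance under GL_3(K) *)

Section Integral.
Variables (K : nonarchLocalFieldType) (p : K).
Hypothesis p_unif : uniformizer p.
Variables (q : nat) (r : 'I_q -> K).
Hypothesis r_intg : forall a, r a \in @intg K.
Hypothesis r_inj : forall a b, r a - r b \in @maxid K -> a = b.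
Hypothesis r_surj : forall x, x \in @intg K -> exists a, x - r a \in @maxid K.
Variable A : nzRingType.
Hypothesis qA : q%:R = 1 :> A.
Local Notation intm := (mxOver (@intg K)).
Local Notation maxm := (mxOver (@maxid K)).
Local Notation V := 'cV[K]_3.
Local Notation p0 := (uniformizer_neq0 p_unif).
Local Notation D := (Dx p).

Lemma exists_expr_scale m n (M : 'M[K]_(m, n)) : exists k, p ^+ k *: M \is a intm.
Proof.
have [->|/exists_scale[c c0 [cM _]]] := eqVneq M 0.
  by exists 0%N; rewrite scaler0 mxOver0 // rpred0.
exists `|vz c|%N; rewrite -(mulfVK c0 (p ^+ _)) -scalerA mxOverZ // intgE.
apply/orP; right; rewrite vzM ?expf_neq0 ?invr_eq0 ?p0 // vzXn ?p0 // vzV //.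
by rewrite (vz_uniformizer p_unif) natz subr_ge0 lez_abs.
Qed.

Lemma expr_scaleS m n (M : 'M[K]_(m, n)) k l : (k <= l)%N ->
  p ^+ k *: M \is a intm -> p ^+ l *: M \is a intm.
Proof.
move=> kl Mk; rewrite -(subnK kl) exprD -scalerA mxOverZ // rpredX //.
exact: uniformizer_intg.
Qed.

Lemma bounded_comp (h : V -> A) C : C \in unitmx -> bounded p h ->
  bounded p (fun x => h (C *m x)).
Proof.
move=> Cu [n hn]; have [k Ck] := exists_expr_scale (invmx C).
exists (n + k)%N => x /hn; rewrite /bounded_by /= => nx.
rewrite -(mulKmx Cu x) addnC exprD -scalerA scalemxAr scalemxAl.
by apply: mxOverM.
Qed.

Lemma periodic_comp (h : V -> A) B C X : X \is a intm -> C *m B = B *m X ->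
  periodic B h -> periodic B (fun x => h (C *m x)).
Proof.
move=> Xi CB ph x y yi /=; rewrite mulmxDr mulmxA CB -mulmxA ph //.
exact: mxOverM.
Qed.

(** Induction on the valuation of the determinant: [smith_step] splits off an element of GL_3(O),
    which permutes the cosets, and one factor [Dx p], which costs q = 1. *)
Lemma coset_sum_comp (h : V -> A) X : X \is a intm -> X \in unitmx ->
  bounded p h -> periodic 1%:M h ->
  coset_sum (fun x => h (X *m x)) = coset_sum h.
Proof.
move=> Xi Xu; have : vz (\det X) = `|vz (\det X)|%N.
  by rewrite gez0_abs // vz_det_intm.
move: `|vz (\det X)|%N => n; elim: n => [|n IHn] in h X Xi Xu *.
  by move=> d0 bh ph; apply: coset_sum_GLO => //; apply: GLO_vz.
move=> dX bh ph.
have [|G [X' [GO X'i XE]]] := smith_step p_unif Xi Xu; first by rewrite dX.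
have [Gi Gu _] := GO; have Du := Dx_unitmx p0.
have Di := Dx_intm (uniformizer_intg p_unif).
have X'u : X' \in unitmx by move: Xu; rewrite XE unitmx_mul => /andP[].
have pG : periodic 1%:M (fun x => h (G *m x)).
  by apply: periodic_comp Gi _ ph; rewrite mulmx1 mul1mx.
have pGD : periodic 1%:M (fun x => h (G *m (D *m x))).
  by apply: (periodic_comp (h := fun x => h (G *m x))) Di _ pG; rewrite mulmx1 mul1mx.
have bG := bounded_comp Gu bh.
transitivity (coset_sum (fun x => h (G *m (D *m (X' *m x))))).
  by apply: eq_fsbigr => x _; rewrite XE !mulmxA.
rewrite (IHn (fun x => h (G *m (D *m x)))) //.
- rewrite (coset_sum_Dx p_unif r_intg r_inj r_surj qA bG pG).
  exact: coset_sum_GLO.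
- move: dX; rewrite XE !vz_detM ?unitmx_mul ?Gu // det_Dx vz_det_GLO //.
  by rewrite (vz_uniformizer p_unif) add0r -[n.+1]add1n PoszD => /addrI.
- exact: (bounded_comp (h := fun x => h (G *m x))).
Qed.

(** Multiplication by [B] identifies K^3 / O^3 with K^3 / lat B, so this is the integral that gives
    a coset of [lat B] the mass 1. *)
Definition lattice_sum (B : 'M[K]_3) (h : V -> A) : A :=
  coset_sum (fun x => h (B *m x)).

Lemma lattice_sum_mul B X h : B \in unitmx -> X \in unitmx -> X \is a intm ->
  bounded p h -> periodic B h -> lattice_sum (B *m X) h = lattice_sum B h.
Proof.
move=> Bu Xu Xi bh ph; rewrite /lattice_sum.
rewrite -[RHS](coset_sum_comp Xi Xu (h := fun x => h (B *m x))).
- by apply: eq_fsbigr => x _; rewrite mulmxA.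
- exact: bounded_comp.
- by move=> x y yi; rewrite mul1mx mulmxDr ph.
Qed.

(** Both lattices contain p^n O^3 for large n, and passing to a sublattice leaves the sum unchanged
    by [lattice_sum_mul]. *)
Lemma lattice_sum_eq B C h : B \in unitmx -> C \in unitmx ->
  bounded p h -> periodic B h -> periodic C h -> lattice_sum B h = lattice_sum C h.
Proof.
move=> Bu Cu bh pB pC.
have [k Bk] := exists_expr_scale (invmx B).
have [l Cl] := exists_expr_scale (invmx C).
have {}Bk := expr_scaleS (leq_maxl k l) Bk.
have {}Cl := expr_scaleS (leq_maxr k l) Cl.
move: (maxn k l) Bk Cl => n Bn Cn.
have pn0 : p ^+ n != 0 by rewrite expf_neq0 ?p0.
have E (M : 'M[K]_3) : M \in unitmx -> p ^+ n *: invmx M \is a intm ->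
    periodic M h -> lattice_sum M h = lattice_sum (p ^+ n)%:M h.
  move=> Mu Mn pM; rewrite -(lattice_sum_mul Mu _ Mn) //.
    by rewrite -scalemxAr mulmxV // scalemx1.
  by rewrite unitmx_scale // unitmx_inv.
by rewrite E // [RHS]E.
Qed.

(** The Schwartz-Bruhat functions: locally constant with compact support. One period lattice has to
    serve all points; for functions on the plane [uniform_level] supplies it. *)
Definition nice (h : V -> A) : Prop :=
  bounded p h /\ exists n, periodic (p ^+ n)%:M h.

(** Any period gives the same value, by [integralE]; 0 is a default for functions with no period
    lattice p^n O^3. *)
Definition integral (h : V -> A) : A :=
  if pselect (exists n, periodic (p ^+ n)%:M h) is left e
  then lattice_sum (p ^+ projT1 (cid e))%:M h else 0.

Lemma expr_unitmx n : (p ^+ n)%:M \in @unitmx K 3.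
Proof. by rewrite unitmxE det_scalar unitfE !expf_neq0 ?p0. Qed.

Lemma integralE B h : B \in unitmx -> nice h -> periodic B h ->
  integral h = lattice_sum B h.
Proof.
move=> Bu [bh eh] pB; rewrite /integral; case: pselect => // e.
case: cid => n /= pn; apply: lattice_sum_eq => //; exact: expr_unitmx.
Qed.

Lemma periodicS m n h : (m <= n)%N -> periodic (p ^+ m)%:M h ->
  periodic (p ^+ n)%:M (h : V -> A).
Proof.
move=> mn ph x y yi; rewrite -(subnKC mn) exprD scalar_mxM -mulmxA ph //.
by rewrite mul_scalar_mx mxOverZ // rpredX // (uniformizer_intg p_unif).
Qed.

Lemma nice_integralD h1 h2 : nice h1 -> nice h2 ->
  nice (h1 \+ h2) /\ integral (h1 \+ h2) = integral h1 + integral h2.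
Proof.
move=> n1 n2; have [[b1 [k p1]] [b2 [l p2]]] := (n1, n2).
have {}p1 := periodicS (leq_maxl k l) p1.
have {}p2 := periodicS (leq_maxr k l) p2.
move: (maxn k l) p1 p2 => n p1 p2.
have p12 : periodic (p ^+ n)%:M (h1 \+ h2) by move=> x y yi /=; rewrite p1 ?p2.
have n12 : nice (h1 \+ h2).
  split; last by exists n.
  have [[u u1] [v v2]] := (b1, b2); exists (maxn u v) => x /=.
  have [E|/u1 + _] := eqVneq (h1 x) 0.
    by rewrite E add0r => /v2; apply: bounded_byS => //; exact: leq_maxr.
  by apply: bounded_byS => //; exact: leq_maxl.
split=> //; rewrite !(integralE (expr_unitmx n)) //.
by apply: (coset_sumD p_unif r_surj); apply: bounded_comp => //; exact: expr_unitmx.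
Qed.

Lemma nice_integral0 : nice (fun=> 0) /\ integral (fun=> 0) = 0.
Proof.
have ph : periodic (p ^+ 0)%:M (fun=> 0 : A) by [].
have nh : nice (fun=> 0 : A).
  by split; [exists 0%N => x; rewrite eqxx|exists 0%N].
split=> //; rewrite (integralE (expr_unitmx 0)) //.
exact: fsbig1.
Qed.

Lemma nice_integral_sum (I : Type) (s : seq I) (P : pred I) (F : I -> V -> A) :
  (forall i, P i -> nice (F i)) ->
  nice (fun x => \sum_(i <- s | P i) F i x) /\
  integral (fun x => \sum_(i <- s | P i) F i x) =
    \sum_(i <- s | P i) integral (F i).
Proof.
move=> nF; elim: s => [|i s [IHn IHs]].
  have -> : (fun x => \sum_(i <- [::] | P i) F i x) = fun=> 0.
    by apply/funext => x; rewrite big_nil.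
  by rewrite big_nil; exact: nice_integral0.
rewrite big_cons; case: ifPn => Pi; last first.
  have -> // : (fun x => \sum_(j <- i :: s | P j) F j x) =
    (fun x => \sum_(j <- s | P j) F j x).
  by apply/funext => x; rewrite big_cons (negbTE Pi).
have -> : (fun x => \sum_(j <- i :: s | P j) F j x) =
    F i \+ (fun x => \sum_(j <- s | P j) F j x).
  by apply/funext => x; rewrite big_cons Pi.
by rewrite -IHs; apply: nice_integralD => //; exact: nF.
Qed.

Lemma periodic_mulmx h g n : periodic (p ^+ n)%:M (h : V -> A) ->
  exists m, periodic (p ^+ m)%:M (fun x => h (g *m x)).
Proof.
move=> pn; have [k gk] := exists_expr_scale g; exists (n + k)%N => x y yi /=.
rewrite mulmxDr mulmxA mul_mx_scalar exprD -scalerA -mul_scalar_mx -mulmxA.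
by rewrite pn // mxOverM.
Qed.

(** If p^m O^3 is a period lattice of the composite, its image under [g] is one of [h], and the two
    sums agree term by term. No determinant factor appears, since all lattices have mass 1. *)
Lemma nice_integral_comp h g : g \in unitmx -> nice h ->
  nice (fun x => h (g *m x)) /\ integral (fun x => h (g *m x)) = integral h.
Proof.
move=> gu nh; have [bh [n ph]] := nh; have [m pm] := periodic_mulmx g ph.
have nhg : nice (fun x => h (g *m x)).
  by split; [exact: bounded_comp|exists m].
have mu := expr_unitmx m.
split=> //; rewrite (integralE mu nhg pm) (@integralE (g *m (p ^+ m)%:M)) //.
- by apply: eq_fsbigr => x _; rewrite !mulmxA.
- by rewrite unitmx_mul gu.
- move=> x y yi; rewrite -{1}(mulKVmx gu x) -mulmxA -mulmxDr.
  by have := pm (invmx g *m x) y yi; rewrite /= mulKVmx.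
Qed.

Lemma nice_integral_coset v :
  nice (fun x => (x - v \is a maxm)%:R) /\
  integral (fun x => (x - v \is a maxm)%:R) = 1.
Proof.
have maxmE (x : V) : (x \is a maxm) = (p^-1 *: x \is a intm).
  by apply/mxOverP/mxOverP => xm i j; have := xm i j; rewrite mxE (maxidP p_unif).
have ph : periodic (p ^+ 1)%:M (fun x => (x - v \is a maxm)%:R : A).
  move=> x y yi; rewrite addrAC; congr (_%:R); apply: congr1.
  rewrite !maxmE scalerDr mul_scalar_mx scalerA mulVf ?p0 // scale1r.
  by rewrite rpredDr.
have nh : nice (fun x => (x - v \is a maxm)%:R).
  split; last by exists 1%N.
  have [k vk] := exists_expr_scale v; exists k => x.
  have [xv _|] := boolP (x - v \is a maxm); last by rewrite eqxx.
  rewrite /bounded_by /= -(subrK v x) scalerDr rpredD // mxOverZ ?maxm_intm //.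
  by rewrite rpredX // (uniformizer_intg p_unif).
split=> //; rewrite (integralE (expr_unitmx 1) nh ph).
rewrite /lattice_sum /coset_sum -(fsbig_widen [set coset_rep (p^-1 *: v)]).
- rewrite fsbig_set1 maxmE mul_scalar_mx scalerBr scalerA mulVf ?p0 // scale1r.
  by rewrite coset_repP.
- by move=> _ ->; exact: coset_reps_rep.
- move=> x [Tx xN] /=; have [|//] := boolP (_ \is a maxm); rewrite maxmE.
  rewrite mul_scalar_mx scalerBr scalerA mulVf ?p0 // scale1r => /coset_rep_eq E.
  by case: xN; rewrite -E coset_reps_id.
Qed.

End Integral.

(** * Uniform local constancy *)

Section Compactness.
Variables (K : nonarchLocalFieldType) (p : K).
Hypothesis p_unif : uniformizer p.
Variables (q : nat) (r : 'I_q -> K).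
Hypothesis r_surj : forall x, x \in @intg K -> exists a, x - r a \in @maxid K.
Local Notation intm := (mxOver (@intg K)).
Local Notation maxm := (mxOver (@maxid K)).
Local Notation V := 'cV[K]_3.
Local Notation p0 := (uniformizer_neq0 p_unif).

Lemma valuation_ge (n : nat) (x : K) :
  (p ^- n * x \in @intg K) = (n%:Z%:E <= valuation x)%E.
Proof.
have [->|x0] := eqVneq x 0; first by rewrite mulr0 rpred0 valuation0 leey.
have pn0 : p ^+ n != 0 by rewrite expf_neq0 ?p0.
rewrite intgE mulf_eq0 invr_eq0 (negbTE pn0) (negbTE x0) /= vzM ?invr_eq0 //.
rewrite vzV // vzXn ?p0 // (vz_uniformizer p_unif) valuationE // lee_fin.
by rewrite natz addrC subr_ge0.
Qed.

Lemma valuation_ge_int (k : int) (x : K) :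
  p ^- `|k| * x \in @intg K -> (k%:E <= valuation x)%E.
Proof.
by rewrite valuation_ge; apply: le_trans; rewrite lee_fin abszE ler_norm.
Qed.

Lemma ultra_bigcup (T : Type) (F : set_system T) (I : finType) (B : I -> set T) :
  UltraFilter F -> F (\bigcup_i B i) -> exists i, F (B i).
Proof.
move=> UF FB; apply: contrapT => /forallNP nFB.
have FC i : F (~` B i) by have [/nFB|] := in_ultra_setVsetC (B i) UF.
have : F (fun x => forall i, (~` B i) x) by apply: filter_forall.
move=> /(filterI FB) /filter_ex[x [[i _ Bi] /(_ i)]]; exact.
Qed.

(** An ultrafilter on integral vectors selects at every level one of the q residue classes of each
    coordinate, so its coordinates are Cauchy and converge by completeness. The limit is primitive
    because primitivity only depends on a vector modulo the maximal ideal. *)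
Lemma compact_primitive : compact [set v : V | primitive v].
Proof.
rewrite compact_ultra => F UF Fprim.
have PF : ProperFilter F by exact: ultra_proper.
have Fi : F [set v : V | v \is a intm].
  by apply: filterS Fprim => v /= /andP[].
have ball i n : exists c, F [set v : V | p ^- n * (v i 0 - c) \in @intg K].
  elim: n => [|n [c Fc]].
    exists 0; apply: filterS Fi => v /= /mxOverP vi.
    by rewrite expr0 invr1 mul1r subr0.
  suff /(ultra_bigcup UF)[a Fa] : F (\bigcup_(a : 'I_q)
      [set v : V | p ^- n.+1 * (v i 0 - (c + p ^+ n * r a)) \in @intg K]).
    by exists (c + p ^+ n * r a).
  apply: filterS Fc => v /= /r_surj[a]; rewrite (maxidP p_unif) => ha.
  exists a => //=; have -> // : p ^- n.+1 * (v i 0 - (c + p ^+ n * r a)) =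
    p^-1 * (p ^- n * (v i 0 - c) - r a).
  rewrite exprS invfM -mulrA; congr (_ * _).
  by rewrite opprD addrA mulrBr mulKf // expf_neq0 ?p0.
have cvgi (i : 'I_3) : exists l : K, (fun v : V => v i 0) @ F --> l.
  suff /cvg_ex[l Fl] : cvg ((fun v : V => v i 0) @ F) by exists l.
  apply: cauchy_cvg => A /valuation_entourage[k kA].
  have [c Fc] := ball i `|k|%N.
  exists ([set x | p ^- `|k| * (x - c) \in @intg K],
          [set x | p ^- `|k| * (x - c) \in @intg K]) => //=.
  move=> [x y] [/= xc yc]; apply: kA => /=; apply: valuation_ge_int.
  by rewrite -(subrKA c) mulrDr rpredD // -opprB mulrN rpredN.
have /choice[l Fl] := cvgi; pose L : V := \col_i l i.
have FL : F --> L.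
  move=> W [P nP PW].
  suff : F [set y : V | forall i j, P i j (y i j)].
    by apply: filterS => y Py; exact: PW.
  apply: (@filter_forall _ _ (fun i => [set y : V | forall j, P i j (y i j)]) F) => i.
  have := nP i 0; rewrite mxE => /(Fl i); rewrite /nbhs /=.
  by apply: filterS => y /= Py j; rewrite (ord1 j).
exists L; split=> //=.
have nL : nbhs L [set v : V | L - v \is a maxm].
  exists (fun i j => [set z | (1%:Z%:E <= valuation (L i j - z)%R)%E]).
    by move=> i j; apply/nbhs_valuationP; exists 1%:Z.
  move=> v /= h; apply/mxOverP => i j; have := h i j.
  by rewrite /= (maxidP p_unif) -[p]expr1 valuation_ge !mxE.
have [v [/= Lv]] := filter_ex (filterI (FL _ nL) Fprim).
rewrite !primitiveE => /andP[vi vm]; apply/andP; split.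
  by rewrite -(subrK v L) rpredD // maxm_intm.
apply: contra vm => h; have -> : v = L - (L - v) by rewrite opprB addrC subrK.
by rewrite rpredB.
Qed.

Definition e0line : P2 K.
Proof.
exists <[(delta_mx 0 0 : V)%R]>%VS; rewrite dim_vline.
have -> // : (delta_mx 0 0 : V) != 0.
apply/negP => /eqP/(congr1 (fun m : V => m 0 0)); rewrite !mxE eqxx => E.
have E1 : (1 : K) = 0 by exact: E.
by have := oner_neq0 K; rewrite E1 eqxx.
Defined.

(* [linev 0] is a junk value. *)
Definition linev (v : V) : P2 K := insubd e0line <[v]>%VS.

Lemma val_linev v : v != 0 -> val (linev v) = <[v]>%VS.
Proof. by move=> v0; rewrite insubdK // unfold_in /= dim_vline v0. Qed.

Lemma linev_line_of (x : set_type [set x : V | x != 0]) : linev (val x) = line_of x.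
Proof. by apply: val_inj; rewrite val_linev //; have := set_valP x. Qed.

Lemma primitive_neq0 (v : V) : primitive v -> v != 0.
Proof.
rewrite primitiveE => /andP[_]; apply: contraNneq => ->.
by apply/mxOverP => i j; rewrite mxE rpred0.
Qed.

Lemma continuous_locally (f : CP2 K) (x : V) : x != 0 ->
  exists n, forall z, z \is a intm -> x + p ^+ n *: z != 0 ->
    val f (linev (x + p ^+ n *: z)) = val f (linev x).
Proof.
move=> x0; have /continuous_intP/(_ (linev x)) := valP f.
rewrite nbhsE => -[O [oO Ox] Of].
have : open (@line_of K @^-1` O) by exact: oO.
case=> W oW WE.
have x_in : x \in [set x : V | x != 0] by exact: mem_set.
have Wx : W x.
  suff : (val @^-1` W) (SigSub x_in : set_type [set x : V | x != 0]) by [].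
  by rewrite WE /= -linev_line_of.
have [P nP PW] : nbhs x W by exact: open_nbhs_nbhs.
have /choice[k kP] (i : 'I_3) : exists k : int,
    [set y | (k%:E <= valuation (x i 0 - y)%R)%E] `<=` P i 0.
  by apply/nbhs_valuationP; exact: nP.
exists (\max_i `|k i|)%N => z zi z0; apply: Of.
have z_in : x + p ^+ (\max_i `|k i|)%N *: z \in [set x : V | x != 0] by exact: mem_set.
suff : (val @^-1` W) (SigSub z_in : set_type [set x : V | x != 0]).
  by rewrite WE /= -linev_line_of.
apply: PW => i j; rewrite (ord1 j); apply: kP => /=.
apply: valuation_ge_int; rewrite !mxE opprD addNKr mulrN rpredN mulrA.
rewrite rpredM //; last exact/mxOverP.
rewrite -(subnKC (leq_bigmax i)) exprD mulKf ?expf_neq0 ?p0 // rpredX //.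
exact: uniformizer_intg.
Qed.

(** Compactness of the primitive vectors makes the radius in [continuous_locally] uniform. The
    exponent [n.+1] is positive so that the translates stay primitive, hence nonzero. *)
Lemma uniform_level (f : CP2 K) : exists n, forall v y, primitive v ->
  y \is a intm -> val f (linev (v + p ^+ n.+1 *: y)) = val f (linev v).
Proof.
have prim_add (v : V) n (y : V) : primitive v ->
    y \is a intm -> primitive (v + p ^+ n.+1 *: y).
  rewrite !primitiveE => /andP[vi vm] yi.
  have pm : p ^+ n.+1 *: y \is a maxm.
    apply/mxOverP => i j; rewrite mxE exprS -mulrA maxidMr ?uniformizer_maxid //.
    by rewrite rpredM ?rpredX ?(uniformizer_intg p_unif) //; apply/mxOverP.
  apply/andP; split; first by rewrite rpredD // maxm_intm.
  apply: contra vm => h; have -> : v = v + p ^+ n.+1 *: y - p ^+ n.+1 *: y.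
    by rewrite addrK.
  by rewrite rpredB.
have := compact_primitive; rewrite compact_near_coveringP.
pose P (n : nat) (v : V) := forall y, y \is a intm ->
  val f (linev (v + p ^+ n.+1 *: y)) = val f (linev v).
move=> /(_ nat \oo P _)[].
  move=> x px; have [n hn] := continuous_locally f (primitive_neq0 px).
  exists ([set v : V | p ^- n.+1 *: (v - x) \is a intm], [set m | (n <= m)%N]).
    split; last by exists n.
    exists (fun i j => [set z | (n.+1%:Z%:E <= valuation (x i j - z)%R)%E]).
      by move=> i j; apply/nbhs_valuationP; exists n.+1%:Z.
    move=> v /= h; apply/mxOverP => i j; rewrite mxE valuation_ge.
    by have := h i j; rewrite /= !mxE -valuationN opprB.
  move=> [v m] [/= vx nm] y yi.
  have hn' z : z \is a intm -> val f (linev (x + p ^+ n.+1 *: z)) = val f (linev x).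
    move=> zi; have := primitive_neq0 (prim_add _ n _ px zi).
    rewrite exprSr -scalerA; apply: hn; rewrite mxOverZ //.
    exact: uniformizer_intg.
  have pn0 : p ^+ n.+1 != 0 by rewrite expf_neq0 ?p0.
  have vE : v = x + p ^+ n.+1 *: (p ^- n.+1 *: (v - x)).
    by rewrite scalerA mulfV // scale1r addrC subrK.
  (* Both [v] and [v + p ^+ m.+1 *: y] lie in x + p^(n+1) O^3, where the function is constant. *)
  rewrite vE hn' // -addrA -(subnKC nm) -addSn exprD -scalerA -scalerDr hn' //.
  by rewrite rpredD // mxOverZ // rpredX // (uniformizer_intg p_unif).
by move=> n _ /(_ n (leqnn n)) h; exists n => v y pv; exact: h.
Qed.

End Compactness.

(** * The lower bound *)

Section InvariantFunctional.
Variables (K : nonarchLocalFieldType) (p : K).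
Hypothesis p_unif : uniformizer p.
Variables (q : nat) (r : 'I_q -> K).
Hypothesis r_intg : forall a, r a \in @intg K.
Hypothesis r_inj : forall a b, r a - r b \in @maxid K -> a = b.
Hypothesis r_surj : forall x, x \in @intg K -> exists a, x - r a \in @maxid K.
Variable A : nzRingType.
Hypothesis qA : q%:R = 1 :> A.
Local Notation intm := (mxOver (@intg K)).
Local Notation maxm := (mxOver (@maxid K)).
Local Notation V := 'cV[K]_3.
Local Notation p0 := (uniformizer_neq0 p_unif).
Local Notation pvec := (point_vec r).
Local Notation nice := (@nice K p A).
Local Notation integral := (@integral K p A).

(** A union of q^2 + q + 1 cosets of p O^3 that meets every line in exactly one orbit of 1 + m; see
    [normalized_sum] and [normalizing_scalar]. *)
Definition normalized (v : V) : bool := [exists w, (v - pvec w) \is a maxm].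

Lemma maxm_add_eq (x y : V) : x - y \is a maxm -> (x \is a maxm) = (y \is a maxm).
Proof.
move=> xy; apply/idP/idP => h; last by rewrite -(subrK y x) rpredD.
have -> : y = x - (x - y) by rewrite opprB addrC subrK.
by rewrite rpredB.
Qed.

Lemma normalizedP v : reflect (exists w, v - pvec w \is a maxm) (normalized v).
Proof. exact: existsP. Qed.

Lemma normalized_primitive v : normalized v -> primitive v.
Proof.
move=> /normalizedP[w vw]; have := point_vec_primitive r_intg w.
rewrite !primitiveE => /andP[wi wm]; apply/andP; split.
  by rewrite -(subrK (pvec w) v) rpredD // maxm_intm.
by rewrite (maxm_add_eq vw).
Qed.

Lemma normalized_add v y : y \is a maxm -> normalized (v + y) = normalized v.
Proof.
move=> ym; apply/normalizedP/normalizedP => -[w vw]; exists w.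
  by rewrite -[v](addrK y) addrAC rpredB.
by rewrite addrAC rpredD.
Qed.

Lemma periodic_normalized :
  periodic (p ^+ 1)%:M (fun v => (normalized v)%:R : A).
Proof.
move=> x y /mxOverP yi; rewrite normalized_add //; apply/mxOverP => i j.
by rewrite mul_scalar_mx mxE maxidMr // uniformizer_maxid.
Qed.

Lemma primitive_scale_intg (u : V) c : primitive u -> primitive (c *: u) -> intgu c.
Proof.
move=> /andP[ui /existsP[i uN]]; rewrite primitiveE => /andP[/mxOverP cui cum].
have uu : intgu (u i 0) by apply: intg_not_maxid => //; exact/mxOverP.
apply: intg_not_maxid.
  have := rpredM (cui i 0) (intgu_intg (intguV uu)).
  by rewrite mxE mulfK // intgu_neq0.
apply: contra cum => cm; apply/mxOverP => k l; rewrite mxE maxidMr //.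
exact/mxOverP.
Qed.

Lemma normalizing_scalar (y : V) : y != 0 -> exists2 c0, c0 != 0 &
  normalized (c0 *: y) /\
  forall c, normalized (c *: y) = (c / c0 - 1 \in @maxid K).
Proof.
move=> /exists_scale[d d0 [dyi [i [j dij]]]].
have dyp : primitive (d *: y).
  by rewrite /primitive dyi; apply/existsP; exists i; rewrite mxE -(ord1 j) dij maxid1.
have [e [w [eu ew]]] := point_vec_normalized r_surj dyp.
have e0 := intgu_neq0 eu; have c00 : e * d != 0 by rewrite mulf_neq0.
rewrite scalerA in ew; exists (e * d) => //.
have n0 : normalized (e * d *: y) by apply/normalizedP; exists w.
split=> // c; set u := e * d *: y in ew n0.
have up := normalized_primitive n0.
have -> : c *: y = (c / (e * d)) *: u by rewrite /u scalerA mulfVK.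
move: (c / _) => t {c}.
have pw := point_vec_primitive r_intg w.
apply/idP/idP => [nt|tm].
  have tu := primitive_scale_intg up (normalized_primitive nt).
  have /normalizedP[w' ew'] := nt.
  have [] // := @point_vec_inj _ _ _ r_intg r_inj t w w' tu.
  have -> : t *: pvec w - pvec w' = t *: u - pvec w' - t *: (u - pvec w).
    by rewrite scalerBr opprB [RHS]addrC addrA subrK.
  rewrite rpredB //; apply/mxOverP => k l; rewrite mxE maxidMl //.
    exact: intgu_intg.
  exact/mxOverP.
have -> : t *: u = u + (t - 1) *: u by rewrite scalerBl scale1r addrC subrK.
rewrite normalized_add //; apply/mxOverP => k l; rewrite mxE maxidMr //.
by case/andP: up => /mxOverP.
Qed.

(** The scalars p^k r_a with -N <= k <= N. Those with r_a a unit represent the classes of K^* modulo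
    1 + m whose valuation is at most N in absolute value. *)
Definition scalar_rep N (j : 'I_(N + N).+1 * 'I_q) : K := p ^- N * p ^+ j.1 * r j.2.

Lemma vz_expr n : vz (p ^+ n) = n%:Z.
Proof. by rewrite vzXn ?p0 // (vz_uniformizer p_unif) natz. Qed.

Lemma scalar_rep_sum N d : d != 0 -> (`|vz d| <= N)%N ->
  \sum_(j : 'I_(N + N).+1 * 'I_q | r j.2 \notin @maxid K)
    (scalar_rep j / d - 1 \in @maxid K)%:R = 1 :> A.
Proof.
move=> d0 dN.
have pn0 n : p ^+ n != 0 by rewrite expf_neq0 ?p0.
have runit a : r a \notin @maxid K -> intgu (r a) by move=> ?; exact: intg_not_maxid.
have kP : (`|(vz d + N%:Z)%R| < (N + N).+1)%N by lia.
have kE : (`|(vz d + N%:Z)%R|%N : int) = vz d + N%:Z by lia.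
pose k : 'I_(N + N).+1 := Ordinal kP.
pose P := p ^- N * p ^+ k.
have P0 : P != 0 by rewrite mulf_neq0 ?invr_eq0.
have vP : vz P = vz d by rewrite vzM ?invr_eq0 // vzV // !vz_expr /k /= kE; lia.
have uu : intgu (d / P).
  rewrite intguE mulf_neq0 ?invr_eq0 // vzM ?invr_eq0 // vzV // vP.
  by apply/eqP; exact: subrr.
have [a ha] := r_surj (intgu_intg uu).
have au : r a \notin @maxid K by rewrite -(maxid_congr ha); case/andP: uu.
rewrite (bigD1 (k, a)) //= big1 ?addr0 => [|[k' a'] /andP[/= a'u ka]].
  suff -> : scalar_rep (k, a) / d - 1 \in @maxid K by [].
  have -> : scalar_rep (k, a) / d - 1 = - ((d / P)^-1 * (d / P - r a)).
    rewrite /scalar_rep /= -/P mulrBr mulVf ?(intgu_neq0 uu) // opprB.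
    by rewrite invf_div mulrAC.
  by rewrite rpredN maxidMl // intgu_intg // intguV.
have [h|//] := boolP (scalar_rep (k', a') / d - 1 \in @maxid K).
have vr b : r b \notin @maxid K -> (r b != 0) /\ vz (r b) = 0.
  by move=> /runit; rewrite intguE => /andP[? /eqP].
have [ra'0 vra'] := vr _ a'u; have [ra0 vra] := vr _ au.
have sd : intgu (scalar_rep (k', a') / d).
  apply: intg_not_maxid; first by rewrite -(subrK 1 (_ / d)) rpredD ?rpred1 ?maxid_intg.
  by rewrite (maxid_congr h) maxid1.
have kk : k' = k.
  apply: val_inj; move: sd; rewrite intguE => /andP[_]; rewrite /scalar_rep /=.
  rewrite !vzM ?mulf_neq0 ?invr_eq0 // vra' !vzV // !vz_expr => /eqP.
  by rewrite /=; move: (nat_of_ord k') (vz d) => m D; clear; lia.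
have ru : intgu (P / d) by rewrite -invf_div; exact: intguV.
case/eqP: ka; rewrite kk; congr (_, _); apply: r_inj.
rewrite -(maxid_mulu _ ru).
have -> : P / d * (r a' - r a) = (scalar_rep (k', a') / d - 1) +
    (P / d) * (d / P - r a).
  rewrite !mulrBr -invf_div mulVf ?(intgu_neq0 uu) // kk /scalar_rep /= -/P.
  by rewrite invf_div addrA subrK mulrAC.
by rewrite rpredD // maxidMl // intgu_intg.
Qed.

Lemma maxid_inv_sub1 x : x != 0 -> (x^-1 - 1 \in @maxid K) = (x - 1 \in @maxid K).
Proof.
have H y : y != 0 -> y - 1 \in @maxid K -> y^-1 - 1 \in @maxid K.
  move=> y0 h; have yu : intgu y.
    apply: intg_not_maxid; first by rewrite -(subrK 1 y) rpredD ?rpred1 ?maxid_intg.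
    by rewrite (maxid_congr h) maxid1.
  have -> : y^-1 - 1 = - (y^-1 * (y - 1)) by rewrite mulrBr mulVf // mulr1 opprB.
  by rewrite rpredN maxidMl // intgu_intg // intguV.
move=> x0; apply/idP/idP; last exact: H.
by move=> /H; rewrite invrK invr_eq0; exact.
Qed.

(** The denominators of [h] and of its inverse bound the valuation from both sides, so finitely many
    scalars [scalar_rep] suffice for all [v] at once. *)
Lemma normalized_scalar_bound (h : 'M[K]_3) : h \in unitmx -> exists N, forall v c,
  primitive v -> c != 0 -> primitive (c *: (h *m v)) -> (`|vz c| <= N)%N.
Proof.
move=> hu; have [n1 h1] := exists_expr_scale p_unif h.
have [n2 h2] := exists_expr_scale p_unif (invmx h).
have H (g : 'M[K]_3) n v c : p ^+ n *: g \is a intm -> primitive v -> c != 0 ->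
    primitive (c *: (g *m v)) -> vz c <= n%:Z.
  move=> gn vp c0; rewrite primitiveE => /andP[_]; apply: contraNle => nc.
  have pn0 : p ^+ n != 0 by rewrite expf_neq0 ?p0.
  rewrite -(mulfVK pn0 c) -scalerA scalemxAl.
  have := mxOverM gn (proj1 (andP vp)) => /mxOverP gv.
  apply/mxOverP => i j; rewrite mxE maxidMr // maxidE vzM ?invr_eq0 // vzV //.
  by rewrite vz_expr subr_gt0 nc orbT.
exists (maxn n1 n2) => v c vp c0 cp.
have c1 := H _ _ _ _ h1 vp c0 cp.
have c2 : vz c^-1 <= n2%:Z.
  apply: (H _ _ _ _ h2 cp); first by rewrite invr_eq0.
  by rewrite -scalemxAr mulKmx // scalerA mulVf // scale1r.
by move: c2; rewrite vzV // => c2; lia.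
Qed.

Definition plane_value (f : CP2 K) (v : V) : A := (val f (linev v))%:~R.

(** The cut-off of the homogeneous function [plane_value f]: each point of the plane is counted on
    one orbit of 1 + m. *)
Definition density (f : CP2 K) (v : V) : A :=
  if normalized v then plane_value f v else 0.

Lemma plane_valueZ f c v : c != 0 -> v != 0 ->
  plane_value f (c *: v) = plane_value f v.
Proof.
move=> c0 v0; rewrite /plane_value; congr (val f _)%:~R; apply: val_inj.
rewrite !val_linev ?scaler_eq0 ?negb_or ?c0 //; apply/vspaceP => x.
apply/vlineP/vlineP => -[k ->]; first by exists (k * c); rewrite scalerA.
by exists (k / c); rewrite scalerA mulfVK.
Qed.

Lemma nice_density f : nice (density f).
Proof.
have [n fn] := uniform_level p_unif r_surj f; split.
  exists 0%N => v; rewrite /density /bounded_by /= expr0 scale1r.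
  by case: ifPn => [/normalized_primitive/andP[]//|]; rewrite eqxx.
exists n.+1 => v y yi; rewrite /density mul_scalar_mx normalized_add; last first.
  apply/mxOverP => i j; rewrite mxE exprS -mulrA maxidMr ?uniformizer_maxid //.
  by rewrite rpredM ?rpredX ?(uniformizer_intg p_unif) //; apply/mxOverP.
case: ifPn => // /normalized_primitive vp.
by rewrite /plane_value fn.
Qed.

Definition invariant_sum (f : CP2 K) : A := integral (density f).

Lemma invariant_sumD f g :
  invariant_sum (f + g) = invariant_sum f + invariant_sum g.
Proof.
rewrite /invariant_sum.
have [_ <-] := nice_integralD p_unif r_intg r_inj r_surj qA (nice_density f) (nice_density g).
congr integral; apply/funext => v; rewrite /density /plane_value /=.
by case: ifP; rewrite ?addr0 // -rmorphD.
Qed.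

Lemma invariant_sumB f g :
  invariant_sum (f - g) = invariant_sum f - invariant_sum g.
Proof. by have := invariant_sumD (f - g) g; rewrite subrK => ->; rewrite addrK. Qed.

Lemma normalized_sum v :
  (normalized v)%:R = \sum_w ((v - pvec w \is a maxm)%:R : A).
Proof.
have [/normalizedP[w vw]|nv] := boolP (normalized v); last first.
  rewrite big1 // => w _; case: (boolP (_ \is a maxm)) => // vw.
  by case/normalizedP: nv; exists w.
rewrite (bigD1 w) //= vw big1 ?addr0 // => w' w'w.
case: (boolP (_ \is a maxm)) => // vw'; case/eqP: w'w; apply/esym.
have [] // := @point_vec_inj _ _ _ r_intg r_inj 1 w w' (intgu1 K).
have -> : 1 *: pvec w - pvec w' = (v - pvec w') - (v - pvec w).
  by rewrite scale1r opprB [RHS]addrC addrA subrK.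
by rewrite rpredB.
Qed.

Lemma invariant_sum_one : invariant_sum (CP2_one K) = 3%:R.
Proof.
rewrite /invariant_sum.
have -> : density (CP2_one K) = fun v => \sum_w (v - pvec w \is a maxm)%:R.
  by apply/funext => v; rewrite -normalized_sum /density; case: ifP.
have NC := nice_integral_coset p_unif r_intg r_inj r_surj qA.
have [_ ->] := nice_integral_sum p_unif r_intg r_inj r_surj qA (index_enum _)
  (fun w (_ : true) => proj1 (NC (pvec w))).
under eq_bigr do rewrite (proj2 (NC _)).
by rewrite sumr_const card_point_index !natrD natrX qA expr1n (natrD _ 1 2) addrA.
Qed.

Lemma nice_if (b : V -> bool) n h : nice h ->
  periodic (p ^+ n)%:M (fun v => (b v)%:R : A) ->
  nice (fun v => if b v then h v else 0).
Proof.
move=> [[k hk] [m hm]] pb; split.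
  by exists k => v; case: ifP => [_ /hk//|]; rewrite eqxx.
have {}hm := periodicS p_unif (leq_maxl m n) hm.
have {}pb := periodicS p_unif (leq_maxr m n) pb.
exists (maxn m n) => v y yi; rewrite hm //; have := pb v y yi.
case: (b _) (b _) => -[] //= /eqP; rewrite ?oner_eq0 // eq_sym.
by rewrite oner_eq0.
Qed.

(* The normalized vectors and their images under [h] both represent the orbits of
   1 + m on K^3 minus 0 up to the scalars [scalar_rep]; those scalars carry one set
   of representatives to the other piece by piece. *)
Lemma invariant_sum_mulmx (f f' : CP2 K) (h : 'M[K]_3) : h \in unitmx ->
  (forall v, v != 0 -> val f' (linev v) = val f (linev (h *m v))) ->
  invariant_sum f' = invariant_sum f.
Proof.
move=> hu ff'; have [N NP] := normalized_scalar_bound hu.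
pose s (j : 'I_(N + N).+1 * 'I_q) := scalar_rep j.
(* [E j] restricts [density f] to those vectors whose preimage under [s j *: h] is normalized, and
   [G j] is its pull-back under that matrix, so the two have equal integrals. *)
pose E j u := if normalized (invmx h *m ((s j)^-1 *: u)) then density f u else 0.
pose G j v := E j ((s j *: h) *m v).
have s0 j : r j.2 \notin @maxid K -> s j != 0.
  move=> ru; have /intgu_neq0 r0 := intg_not_maxid (r_intg _) ru.
  by rewrite /s /scalar_rep !mulf_neq0 ?invr_eq0 ?expf_neq0 ?p0.
have nE j : nice (E j).
  have [n pn] := periodic_mulmx p_unif ((s j)^-1 *: invmx h) periodic_normalized.
  apply: (nice_if (nice_density f) (n := n)) => v y yi.
  by have := pn v y yi; rewrite /= -!scalemxAl -!scalemxAr.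
have IE := nice_integral_sum p_unif r_intg r_inj r_surj qA (index_enum _)
  (P := fun j : 'I_(N + N).+1 * 'I_q => r j.2 \notin @maxid K).
have EG j : r j.2 \notin @maxid K -> nice (G j) /\ integral (G j) = integral (E j).
  move=> ru; apply: (nice_integral_comp p_unif r_intg r_inj r_surj qA _ (nE j)).
  by rewrite unitmx_scale // s0.
(* For normalized [v], exactly one class of scalars [s j] makes [s j *: (h *m v)] normalized. *)
transitivity (integral (fun v => \sum_(j | r j.2 \notin @maxid K) G j v)).
  congr integral; apply/funext => v; rewrite {1}/density.
  have GE j : r j.2 \notin @maxid K ->
      G j v = if normalized v then density f (s j *: (h *m v)) else 0.
    by move=> /s0 sj0; rewrite /G /E -scalemxAl scalerA mulVf // scale1r mulKmx.
  case: ifPn => [nv|nv]; last by rewrite big1 // => j /GE ->; rewrite (negbTE nv).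
  have vp := normalized_primitive nv; have v0 := primitive_neq0 vp.
  have hv0 : h *m v != 0.
    by apply: contraNneq v0 => E0; rewrite -(mulKmx hu v) E0 mulmx0.
  have [c0 c00 [nc0 cE]] := normalizing_scalar hv0.
  transitivity (\sum_(j | r j.2 \notin @maxid K)
      (s j / c0 - 1 \in @maxid K)%:R * plane_value f (h *m v)).
    rewrite -mulr_suml scalar_rep_sum ?mul1r //; last first.
      exact: NP vp c00 (normalized_primitive nc0).
    by rewrite /plane_value ff'.
  apply: eq_bigr => j ru; rewrite GE // nv /density cE.
  by case: ifP; rewrite ?mul1r ?mul0r // plane_valueZ // s0.
have [_ ->] := IE G (fun j ru => proj1 (EG j ru)).
under eq_bigr => j ru do rewrite (proj2 (EG j ru)).
have [_ <-] := IE E (fun j _ => nE j).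
congr integral; apply/funext => u.
have [nu|nu] := boolP (normalized u); last first.
  rewrite /density (negbTE nu) big1 // => j _.
  by rewrite /E /density (negbTE nu) if_same.
have up := normalized_primitive nu; have u0 := primitive_neq0 up.
have hu0 : invmx h *m u != 0.
  by apply: contraNneq u0 => E0; rewrite -(mulKVmx hu u) E0 mulmx0.
have [c0 c00 [nc0 cE]] := normalizing_scalar hu0.
have c0V : c0^-1 != 0 by rewrite invr_eq0.
(* Here [j] is selected by the inverse of [s j] agreeing with [c0] modulo 1 + m, so [scalar_rep_sum]
   is applied to the inverse of [c0]. *)
transitivity (\sum_(j | r j.2 \notin @maxid K)
    (s j / c0^-1 - 1 \in @maxid K)%:R * density f u); last first.
  rewrite -mulr_suml scalar_rep_sum ?mul1r //.
  apply: NP (normalized_primitive nc0) c0V _.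
  by rewrite -scalemxAr mulKVmx // scalerA mulVf // scale1r.
apply: eq_bigr => j /s0 sj0; rewrite /E -scalemxAr cE.
rewrite -invfM (maxid_inv_sub1 (mulf_neq0 sj0 c00)) invrK.
by case: ifP; rewrite ?mul1r ?mul0r.
Qed.

Lemma invariant_sum_act g f : invariant_sum (CP2_act g f) = invariant_sum f.
Proof.
apply: (invariant_sum_mulmx (valP (repr g^-1%g))) => v v0 /=.
congr (val f _); apply: val_inj.
have hv0 : val (repr g^-1%g) *m v != 0.
  apply: contraNneq v0 => E0.
  by rewrite -(mulKmx (valP (repr g^-1%g)) v) E0 mulmx0.
by rewrite val_linev //= val_linev // limg_line lfunE.
Qed.

Lemma coinvariant_invariant_sum (Gamma : {pred PGL3 K}) f :
  f \in coinvariant_submodule Gamma -> invariant_sum f = 0.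
Proof.
move=> /asboolP/(_ (fun f => invariant_sum f == 0)) fS; apply/eqP/fS.
- split=> [|f1 f2]; first by rewrite unfold_in -(subrr (0 : CP2 K)) invariant_sumB subrr.
  by rewrite !unfold_in invariant_sumB => /eqP -> /eqP ->; rewrite subrr.
- by move=> g f' _; rewrite !unfold_in invariant_sum_act.
- by move=> g _ f'; rewrite unfold_in invariant_sumB invariant_sum_act subrr.
Qed.

Lemma invariant_sumMn f n : invariant_sum (f *+ n) = invariant_sum f *+ n.
Proof.
elim: n => [|n IHn]; last by rewrite !mulrS invariant_sumD IHn.
by rewrite !mulr0n -(subrr (0 : CP2 K)) invariant_sumB subrr.
Qed.

End InvariantFunctional.

Lemma coinvariant_class_eq0 (K : nonarchLocalFieldType) (Gamma : {pred PGL3 K}) f :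
  coinvariant_class Gamma f = 0 <-> f \in coinvariant_submodule Gamma.
Proof.
rewrite -[f in X in _ <-> X]subr0 Quotient.idealrBE /coinvariant_class.
by rewrite raddf0; split=> /eqP.
Qed.

Lemma coinvariant_class_order_ge (K : nonarchLocalFieldType) (q : nat)
    (Gamma : {pred PGL3 K}) m :
  (residue_field K #= `I_q)%card -> (1 < q)%N -> q <> 1 %[mod 3] ->
  coinvariant_class Gamma (CP2_one K) *+ m = 0 -> (q - 1 %| m)%N.
Proof.
move=> Kq q1 q3 Em.
(* The case q = 2 is separate because ['Z_1] is not the zero ring: ['Z_n] has n elements only for n
   > 1. *)
have [q2|q_gt2] := leqP (q - 1) 1.
  by have -> : (q - 1 = 1)%N; [lia | rewrite dvd1n].
have [p p_unif] := exists_uniformizer K.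
have [r [r_intg r_inj r_surj]] := residue_representatives Kq.
pose A : nzRingType := 'Z_(q - 1).
have natA n : (n%:R == 0 :> A) = (q - 1 %| n)%N.
  by rewrite -val_eqE /= val_Zp_nat.
have qA : q%:R = 1 :> A.
  by apply/eqP; rewrite -subr_eq0 -[X in _ - X]/(1%:R) -natrB ?natA // ltnW.
have : invariant_sum p r A (CP2_one K *+ m) = 0.
  apply: (coinvariant_invariant_sum p_unif r_intg r_inj r_surj qA (Gamma := Gamma)).
  by apply/coinvariant_class_eq0; rewrite /coinvariant_class raddfMn.
rewrite (invariant_sumMn p_unif r_intg r_inj r_surj qA).
rewrite (invariant_sum_one p_unif r_intg r_inj r_surj qA) -mulrnA => /eqP.
rewrite natA Gauss_dvdr // coprime_sym prime_coprime //.
by apply: contra_notN q3 => d3; rewrite -(subnK (ltnW q1)) -modnDml (eqP d3).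
Qed.

(** * Points of the plane and pairs of lattices *)

Section Jumps.
Variables (K : nonarchLocalFieldType) (p : K).
Hypothesis p_unif : uniformizer p.
Local Notation intm := (mxOver (@intg K)).
Local Notation maxm := (mxOver (@maxid K)).
Local Notation V := 'cV[K]_3.
Local Notation e0 := (delta_mx 0 0 : 'cV[K]_3).
Local Notation p0 := (uniformizer_neq0 p_unif).
Local Notation D := (Dx p).
Local Notation Du := (Dx_unitmx p0).

Definition jump (L M : set V) (xi : P2 K) : Prop :=
  exists2 v, v \in val xi & M v /\ ~ L v.

(** The lattice meets the line in a rank-one module spanned by a vector that is primitive in the
    lattice and extends to a basis. Questions about the line then reduce to the single vector
    [C' *m e0]. *)
Lemma line_basis (xi : P2 K) (C : 'M[K]_3) : C \in unitmx ->
  exists C', [/\ C' \in unitmx, lat C' = lat C & val xi = <[C' *m e0]>%VS].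
Proof.
move=> Cu; pose v := vpick (val xi).
have v0 : v != 0.
  by rewrite vpick0; apply: contraTneq (valP xi) => ->; rewrite dimv0.
have xiE : val xi = <[v]>%VS.
  apply/esym/eqP; rewrite eqEdim (eqP (valP xi)) dim_vline v0 andbT.
  by rewrite -memvE memv_pick.
have Cv0 : invmx C *m v != 0.
  by apply: contraNneq v0 => E; rewrite -(mulKVmx Cu v) E mulmx0.
have [c c0 [ci [i [j cij]]]] := exists_scale Cv0.
have cp : primitive (c *: (invmx C *m v)).
  by rewrite /primitive ci; apply/existsP; exists i; rewrite mxE -(ord1 j) cij maxid1.
have [G GO Ge] := primitive_completion cp; have [_ Gu _] := GO.
exists (C *m G); split; rewrite ?unitmx_mul ?Cu ?lat_GLO // xiE.
rewrite -mulmxA Ge -scalemxAr mulKVmx //; apply/vspaceP => x.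
apply/vlineP/vlineP => -[k ->]; first by exists (k / c); rewrite scalerA mulfVK.
by exists (k * c); rewrite scalerA.
Qed.

Lemma latZ (B : 'M[K]_3) c x : B \in unitmx -> c \in @intg K -> lat B x -> lat B (c *: x).
Proof.
by move=> Bu ci /(latP _ Bu) xi; apply/(latP _ Bu); rewrite -scalemxAr mxOverZ.
Qed.

Lemma latD (B : 'M[K]_3) x y : B \in unitmx -> lat B x -> lat B y -> lat B (x + y).
Proof.
move=> Bu /(latP _ Bu) xi /(latP _ Bu) yi; apply/(latP _ Bu).
by rewrite mulmxDr rpredD.
Qed.

Lemma lat_scale_e0 (C : 'M[K]_3) c : C \in unitmx -> lat C (c *: (C *m e0)) <-> c \in @intg K.
Proof.
move=> Cu; rewrite latP // -scalemxAr mulKmx //; split=> [/mxOverP/(_ 0 0)|ci].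
  by rewrite !mxE !eqxx mulr1.
by rewrite mxOverZ //; apply/mxOverP => i j; rewrite mxE rpred_nat.
Qed.

Lemma latZ_lat (B : 'M[K]_3) c x : c != 0 -> lat (c *: B) (c *: x) <-> lat B x.
Proof.
move=> c0; rewrite -scaled_lat; split=> [[y yB /(scalerI c0) <-] //|xB].
by exists x.
Qed.

(** A multiple [c *: (C *m e0)] in [lat B'] has [c] integral, and it lies in [lat B] as soon as [c]
    is in the maximal ideal. So a vector witnessing the jump is a unit multiple of [C *m e0]. *)
Lemma jump_basis (B B' C : 'M[K]_3) xi : B \in unitmx -> B' \in unitmx ->
  C \in unitmx -> val xi = <[C *m e0]>%VS ->
  lat (p *: C) `<=` lat B -> lat B' `<=` lat C ->
  jump (lat B) (lat B') xi <-> lat B' (C *m e0) /\ ~ lat B (C *m e0).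
Proof.
move=> Bu B'u Cu xiE pB BC; split=> [[x]|[h1 h2]]; last first.
  by exists (C *m e0); rewrite ?xiE ?memv_line.
rewrite xiE => /vlineP[c ->] [h1 h2].
have ci : c \in @intg K by apply/(lat_scale_e0 _ Cu)/BC.
have cN : c \notin @maxid K.
  apply/negP => cm; apply/h2/pB.
  have -> : c *: (C *m e0) = p *: ((p^-1 * c) *: (C *m e0)).
    by rewrite scalerA mulVKf ?p0.
  by apply/latZ_lat; rewrite ?p0 //; apply/lat_scale_e0; rewrite // -maxidP.
have cu := intg_not_maxid ci cN; have c0 := intgu_neq0 cu.
split=> [|h]; last by apply: h2; apply: latZ.
have -> : C *m e0 = c^-1 *: (c *: (C *m e0)) by rewrite scalerA mulVf ?scale1r.
by apply: latZ => //; exact/intgu_intg/intguV.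
Qed.

Lemma lat_DxK (C : 'M[K]_3) : C \in unitmx -> lat (p *: C) `<=` lat (C *m D).
Proof.
move=> Cu; have CDu : C *m D \in unitmx by rewrite unitmx_mul Cu Du.
rewrite lat_sub ?unitmx_scale ?p0 //.
have -> : p *: C = C *m D *m (p *: Dx p^-1).
  by rewrite -scalemxAr -mulmxA Dx_mul mulfV ?p0 // Dx1 mulmx1.
rewrite mulKmx //; apply/mxOverP => i j; rewrite !mxE mulrnAr rpredMn //.
case: ifP => _; first by rewrite mulfV ?p0 // rpred1.
by rewrite mulr1 (uniformizer_intg p_unif).
Qed.

Lemma lat_Dx_sub (C : 'M[K]_3) : C \in unitmx -> lat (C *m D) `<=` lat C.
Proof.
by move=> Cu; apply: (neighbour_sub p_unif); exists C.
Qed.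

Lemma jump_neighbour (C C' : 'M[K]_3) xi : C \in unitmx -> C' \in unitmx ->
  lat C' = lat C -> val xi = <[C' *m e0]>%VS ->
  jump (lat (C *m D)) (lat C) xi <-> ~ lat (C *m D) (C' *m e0).
Proof.
move=> Cu C'u CC' xiE; have CDu : C *m D \in unitmx by rewrite unitmx_mul Cu Du.
rewrite (jump_basis CDu Cu C'u xiE).
- split=> [[] //|h]; split=> //; rewrite -CC' -[C' *m e0]scale1r.
  by apply/lat_scale_e0; rewrite ?rpred1.
- by rewrite -scaled_lat CC' scaled_lat; exact: lat_DxK.
- by rewrite CC'.
Qed.

(** In p C < C D < C the line grows exactly once. The complement of such a jump set is therefore a
    jump set again, which makes these open sets clopen. *)
Lemma jump_neighbourC (C : 'M[K]_3) xi : C \in unitmx ->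
  ~ jump (lat (C *m D)) (lat C) xi <-> jump (lat (p *: C)) (lat (C *m D)) xi.
Proof.
move=> Cu; have [C' [C'u CC' xiE]] := line_basis xi Cu.
have CDu : C *m D \in unitmx by rewrite unitmx_mul Cu Du.
have pCu : p *: C \in unitmx by rewrite unitmx_scale ?p0.
rewrite (jump_neighbour Cu C'u CC' xiE) notK.
rewrite (jump_basis pCu CDu C'u xiE).
- split=> [h|[] //]; split=> //; rewrite -scaled_lat -CC' scaled_lat.
  have -> : C' *m e0 = p *: (p^-1 *: (C' *m e0)).
    by rewrite scalerA mulfV ?p0 // scale1r.
  move=> /latZ_lat; rewrite ?p0 // => /(_ isT)/lat_scale_e0 => /(_ C'u).
  by rewrite -[p^-1]mulr1 -maxidP // (negbTE (maxid1 K)).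
- by rewrite -!scaled_lat CC'.
- by rewrite CC'; exact: lat_Dx_sub.
Qed.

Lemma nbhs_lat (B : 'M[K]_3) c (x : V) : B \in unitmx ->
  nbhs x [set y : V | lat B (c *: y) <-> lat B (c *: x)].
Proof.
move=> Bu; pose N := c *: invmx B.
have : nbhs (N *m x) [set z : V | N *m x - z \is a intm].
  exists (fun i j => [set z | (0%:Z%:E <= valuation ((N *m x) i j - z)%R)%E]).
    by move=> i j; apply/nbhs_valuationP; exists 0.
  by move=> z h; apply/mxOverP => i j; have := h i j; rewrite /= !mxE.
move=> nN; have : nbhs x [set y : V | N *m x - N *m y \is a intm].
  exact: (@mulmx_continuous K 3 3 N x _ nN).
apply: filterS => y /=.
move=> h; have E z : invmx B *m (c *: z) = N *m z by rewrite -scalemxAr scalemxAl.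
rewrite !latP // !E; split=> h'.
  by rewrite -(subrK (N *m y) (N *m x)) rpredD.
have -> : N *m y = N *m x - (N *m x - N *m y) by rewrite opprB addrC subrK.
by rewrite rpredB.
Qed.

Lemma open_jump (B B' : 'M[K]_3) : B \in unitmx -> B' \in unitmx ->
  open [set xi : P2 K | jump (lat B) (lat B') xi].
Proof.
move=> Bu B'u.
suff : open (@line_of K @^-1` [set xi | jump (lat B) (lat B') xi]) by [].
pose W := [set x : V | exists c, lat B' (c *: x) /\ ~ lat B (c *: x)].
exists W; last first.
  apply/seteqP; split=> x /=.
    by move=> [c h]; exists (c *: val x) => //=; apply/vlineP; exists c.
  by move=> [_ /vlineP[c ->] h]; exists c.
rewrite openE => x [c [h1 h2]].
apply: filterS2 (nbhs_lat c x Bu) (nbhs_lat c x B'u) => y h3 h4.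
by exists c; split; [apply/h4|move/h3].
Qed.

Definition indicator (S : set (P2 K)) : P2 K -> int := fun xi => (`[< S xi >] : nat)%:Z.

Lemma continuous_indicator (C : 'M[K]_3) : C \in unitmx ->
  indicator (jump (lat (C *m D)) (lat C)) \in @continuous_int K.
Proof.
move=> Cu; apply/continuous_intP => xi.
have CDu : C *m D \in unitmx by rewrite unitmx_mul Cu Du.
have pCu : p *: C \in unitmx by rewrite unitmx_scale ?p0.
have [h|h] := pselect (jump (lat (C *m D)) (lat C) xi).
  apply: filterS (open_nbhs_nbhs (conj (open_jump CDu Cu) h)) => y /= hy.
  by rewrite /indicator; congr (nat_of_bool _)%:Z; apply: asbool_equiv_eq.
have h' := h; move/(jump_neighbourC _ Cu) in h'.
apply: filterS (open_nbhs_nbhs (conj (open_jump pCu CDu) h')) => y /=.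
move=> /(jump_neighbourC _ Cu) hy.
by rewrite /indicator; congr (nat_of_bool _)%:Z; apply: asbool_equiv_eq.
Qed.

End Jumps.

(** * Edges and chambers of the building *)

Section BuildingEdges.
Variables (K : nonarchLocalFieldType) (p : K).
Hypothesis p_unif : uniformizer p.
Local Notation intm := (mxOver (@intg K)).
Local Notation V := 'cV[K]_3.
Local Notation e0 := (delta_mx 0 0 : 'cV[K]_3).
Local Notation p0 := (uniformizer_neq0 p_unif).
Local Notation D := (Dx p).
Local Notation Du := (Dx_unitmx p0).
Local Notation vertex := (building_vertex K).
Implicit Types u v : vertex.

Lemma latticeP (L : set V) : is_lattice L <-> exists2 B, B \in unitmx & L = lat B.
Proof. by split=> -[B Bu ->]; exists B. Qed.

Lemma mulDu (C : 'M[K]_3) : C \in unitmx -> C *m D \in unitmx.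
Proof. by move=> Cu; rewrite unitmx_mul Cu Du. Qed.

Lemma vz_detD (C : 'M[K]_3) : C \in unitmx -> vz (\det (C *m D)) = vz (\det C) + 1.
Proof. by move=> Cu; rewrite vz_detM ?Du // det_Dx (vz_uniformizer p_unif). Qed.

Lemma lattice_class_id (L : set V) : lattice_class L L.
Proof.
exists 1; first exact: oner_neq0.
by apply/seteqP; split=> [_ [x xL <-]|x xL]; rewrite ?scale1r //; exists x; rewrite ?scale1r.
Qed.

Lemma lattice_class_eq (B : 'M[K]_3) (L : set V) :
  lattice_class (lat B) = lattice_class L ->
  exists2 a, a != 0 & L = lat (a *: B).
Proof.
move=> E; have := lattice_class_id L; rewrite -E => -[a a0 <-].
by exists a; rewrite ?scaled_lat.
Qed.

Lemma lattice_classZ a (B : 'M[K]_3) : a != 0 ->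
  lattice_class (lat (a *: B)) = lattice_class (lat B).
Proof.
move=> a0; apply/seteqP; split=> _ [c c0 <-].
  exists (c * a); first exact: mulf_neq0.
  by rewrite !scaled_lat scalerA.
exists (c / a); first by rewrite /= mulf_neq0 ?invr_eq0.
by rewrite !scaled_lat scalerA mulfVK.
Qed.

(** The directed edge from [u] to [v] in matrix form, free of typings. *)
Definition edge_basis (C : 'M[K]_3) u v : Prop :=
  [/\ C \in unitmx, val u = lattice_class (lat (C *m D)) &
      val v = lattice_class (lat C)].

Lemma edge_basisZ a C u v : a != 0 -> edge_basis C u v -> edge_basis (a *: C) u v.
Proof.
move=> a0 [Cu uE vE]; split; rewrite ?unitmx_scale // -?scalemxAl lattice_classZ //.
Qed.

Lemma edge_basis_source C u v B : edge_basis C u v -> B \in unitmx ->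
  val u = lattice_class (lat B) -> exists2 C', edge_basis C' u v & lat (C' *m D) = lat B.
Proof.
move=> eC Bu; have [Cu -> vE] := eC => /lattice_class_eq[a a0 ->].
by exists (a *: C); [exact: edge_basisZ|rewrite scalemxAl].
Qed.

Lemma vz0_intgu (b : K) : b != 0 -> vz b = 0 -> intgu b.
Proof. by move=> b0 vb; rewrite intguE b0 vb. Qed.

Lemma edge_basis_uniq C C' u v : edge_basis C u v -> edge_basis C' u v ->
  lat (C *m D) = lat (C' *m D) -> lat C = lat C'.
Proof.
move=> [Cu _ vE] [C'u _ vE'] E.
have [b b0 bE] := lattice_class_eq (etrans (esym vE) vE').
have := lat_eq_vz (mulDu Cu) (mulDu C'u) E.
rewrite !vz_detD // => /addIr dE.
have bCu : b *: C \in unitmx by rewrite unitmx_scale.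
have := lat_eq_vz C'u bCu bE; rewrite vz_detZ // -dE => dE'.
have vb : vz b = 0.
  by move: dE'; move: (vz b) (vz (\det C)) => x y; clear; lia.
by rewrite bE lat_unitZ //; exact: vz0_intgu.
Qed.

Lemma jumpZ a (B B' : 'M[K]_3) xi : a != 0 ->
  jump (lat (a *: B)) (lat (a *: B')) xi <-> jump (lat B) (lat B') xi.
Proof.
move=> a0; split=> -[x xxi [h1 h2]].
  have xE : x = a *: (a^-1 *: x) by rewrite scalerA mulfV // scale1r.
  exists (a^-1 *: x); first by rewrite memvZ.
  by split; [apply/(latZ_lat _ _ a0); rewrite -xE|move/(latZ_lat _ _ a0); rewrite -xE].
exists (a *: x); first by rewrite memvZ.
by split; [apply/(latZ_lat _ _ a0)|move/(latZ_lat _ _ a0)].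
Qed.

Definition between u v : set (P2 K) :=
  [set xi | exists2 C, edge_basis C u v & jump (lat (C *m D)) (lat C) xi].

(** Edge bases of one edge give the same two lattices up to a common scalar, and jumps are
    unaffected by scaling both lattices. *)
Lemma betweenE C u v xi : edge_basis C u v ->
  between u v xi <-> jump (lat (C *m D)) (lat C) xi.
Proof.
move=> eC; split=> [[C1 eC1]|h]; last by exists C.
have [Cu uE _] := eC; have [C1u uE1 _] := eC1.
have [a a0 aE] := lattice_class_eq (etrans (esym uE1) uE).
rewrite -(jumpZ _ _ _ a0) scalemxAl.
have eaC1 := edge_basisZ a0 eC1.
rewrite scalemxAl in aE; rewrite -aE.
by rewrite (edge_basis_uniq eaC1 eC (esym aE)).
Qed.

Lemma lat_proper_vz (B C : 'M[K]_3) : B \in unitmx -> C \in unitmx ->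
  lat B `<` lat C -> vz (\det C) < vz (\det B).
Proof.
move=> Bu Cu [sBC nCB]; rewrite lt_neqAle lat_sub_vz // andbT.
apply/eqP => dE; apply: nCB.
by rewrite (lat_sub_eq Bu Cu sBC (esym dE)).
Qed.

Lemma neighbour_proper (C : 'M[K]_3) : C \in unitmx -> lat (C *m D) `<` lat C.
Proof.
move=> Cu; split; first exact: lat_Dx_sub.
move=> /(lat_sub_vz Cu (mulDu Cu)); rewrite vz_detD //.
by rewrite gerDl.
Qed.

Lemma lat_sub_scaledV (C : 'M[K]_3) (a : K) : uniformizer a -> C \in unitmx ->
  lat C `<=` scaled a^-1 (lat (C *m D)).
Proof.
move=> au Cu; have a0 := uniformizer_neq0 au.
rewrite scaled_lat; apply/lat_sub => //; first by rewrite unitmx_scale ?invr_eq0 ?mulDu.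
have {2}-> : C = a^-1 *: (C *m D) *m (a *: Dx p^-1).
  rewrite -scalemxAl -scalemxAr scalerA mulVf // scale1r -mulmxA Dx_mul mulfV ?p0 //.
  by rewrite Dx1 mulmx1.
rewrite mulKmx ?unitmx_scale ?invr_eq0 ?mulDu //.
apply/mxOverP => i j; rewrite !mxE mulrnAr rpredMn //; case: ifP => _.
  rewrite intgE mulf_eq0 invr_eq0 (negbTE a0) (negbTE p0) vzM ?invr_eq0 ?p0 //.
  by rewrite vzV ?p0 // (vz_uniformizer p_unif) (vz_uniformizer au).
by rewrite mulr1 (uniformizer_intg au).
Qed.

(** An intermediate lattice has the same v(det) as one of the two ends, so index q implies
    maximality. *)
Lemma typing_edge (t : vertex -> 'Z_3) C u v : is_typing t -> edge_basis C u v ->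
  t v = t u + 1.
Proof.
move=> tt [Cu uE vE]; apply: (tt (lat (C *m D)) (lat C) p) => //.
- by exists (C *m D) => //; exact: mulDu.
- by exists C.
- split; first exact: neighbour_proper.
  move=> _ [B Bu ->] sB sC; rewrite -/(lat B) in sB sC *.
  have := lat_sub_vz (mulDu Cu) Bu sB; have := lat_sub_vz Bu Cu sC.
  rewrite vz_detD // le_eqVlt => /predU1P[E _|lt le]; first by right; exact: lat_sub_eq.
  left; apply/esym/lat_sub_eq => //; first exact: mulDu.
  rewrite vz_detD //; apply/eqP; rewrite eq_le le andbT.
  by move: lt; rewrite -lezD1.
- exact: lat_sub_scaledV.
Qed.

Lemma Z3_neq (x y : 'Z_3) : y = x + 1 -> x <> y + 1 /\ x <> y.
Proof.
move=> ->; split=> /eqP; rewrite -subr_eq0.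
  by rewrite opprD addrA opprD addrA subrr.
by rewrite opprD addrA subrr.
Qed.

(** Along the chain of a chamber v(det) drops strictly three times and by 3 in total, so every
    inclusion has index q. The typing then rules out the reversed and the degenerate positions of
    [u] and [v]. *)
Lemma building_edge_basis u v : building_edge u v -> exists C, edge_basis C u v.
Proof.
move=> [[c [L0 [L1 [L2 [a [[l0 l1 l2 au] [s01 s12 s20 cE]]]]]]] uvc [t tt tE]].
have a0 := uniformizer_neq0 au; have aV0 : a^-1 != 0 by rewrite invr_eq0.
move: l0 l1 l2 => /latticeP[B0 B0u E0] /latticeP[B1 B1u E1] /latticeP[B2 B2u E2].
rewrite {}E0 {}E1 {}E2 scaled_lat in s01 s12 s20 cE.
have B3u : a^-1 *: B0 \in unitmx by rewrite unitmx_scale.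
have d01 := lat_proper_vz B0u B1u s01; have d12 := lat_proper_vz B1u B2u s12.
have d20 := lat_proper_vz B2u B3u s20.
rewrite vz_detZ // vzV // (vz_uniformizer au) in d20.
have [e1 e2 e3] : [/\ vz (\det B0) = vz (\det B1) + 1,
    vz (\det B1) = vz (\det B2) + 1 & vz (\det B2) = vz (\det (a^-1 *: B0)) + 1].
  rewrite vz_detZ // vzV // (vz_uniformizer au).
  move: (vz (\det B0)) (vz (\det B1)) (vz (\det B2)) d01 d12 d20.
  by clear; move=> x y z *; split; lia.
have N1 := neighbourI p_unif B0u B1u (proj1 s01) e1.
have N2 := neighbourI p_unif B1u B2u (proj1 s12) e2.
have N3 := neighbourI p_unif B2u B3u (proj1 s20) e3.
have mk L M : neighbour p L M -> val u = lattice_class L -> val v = lattice_class M ->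
    exists C, edge_basis C u v.
  by move=> [C Cu [-> ->]] uE vE; exists C.
have mk' L M : neighbour p L M -> val v = lattice_class L -> val u = lattice_class M ->
    exists C, edge_basis C u v.
  move=> [C Cu [-> ->]] uE vE; have eC : edge_basis C v u by [].
  by have [] := Z3_neq (typing_edge tt eC).
have same L : val v = L -> val u = L -> exists C, edge_basis C u v.
  move=> vE uE; have uv : u = v by apply: val_inj; rewrite uE vE.
  by have [_] := Z3_neq tE; rewrite uv.
have B03 : lattice_class (lat B0) = lattice_class (lat (a^-1 *: B0)).
  by rewrite lattice_classZ.
have uc : c u by apply: uvc; left.
have vc : c v by apply: uvc; right.
move: uc vc; rewrite cE /= => -[uE|uE|uE] [vE|vE|vE].
- exact: same vE uE.
- exact: mk N1 uE vE.
- by rewrite B03 in uE; exact: mk' N3 vE uE.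
- exact: mk' N1 vE uE.
- exact: same vE uE.
- exact: mk N2 uE vE.
- by rewrite B03 in vE; exact: mk N3 uE vE.
- exact: mk' N2 vE uE.
- exact: same vE uE.
Qed.

(** Scaling changes v(det) by a multiple of 3, so v(det) modulo 3 belongs to the vertex. Two
    opposite edges would make 2 divisible by 3. *)
Lemma edge_basis_asym C C' u v : edge_basis C u v -> ~ edge_basis C' v u.
Proof.
move=> [Cu uE vE] [C'u vE' uE'].
have [a a0 aE] := lattice_class_eq (etrans (esym uE) uE').
have [b b0 bE] := lattice_class_eq (etrans (esym vE) vE').
have aCu : a *: (C *m D) \in unitmx by rewrite unitmx_scale ?mulDu.
have bCu : b *: C \in unitmx by rewrite unitmx_scale.
have := lat_eq_vz C'u aCu aE; have := lat_eq_vz (mulDu C'u) bCu bE.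
rewrite !vz_detZ ?mulDu // !vz_detD //.
move: (vz a) (vz b) (vz (\det C)) (vz (\det C')) => x y z w.
by clear; lia.
Qed.

Lemma edge_basis_irrefl C u : ~ edge_basis C u u.
Proof. by move=> eC; exact: (edge_basis_asym eC eC). Qed.

Lemma edge_basis_chamber C u v : edge_basis C u v ->
  exists2 c, building_chamber c & [set u; v] `<=` c.
Proof.
move=> [Cu uE vE].
pose P : 'M[K]_3 := tperm_mx 0 (inord 1).
have Pi : P \is a intm by apply/mxOverP => i j; rewrite !mxE rpred_nat.
have PP : P *m P = 1%:M by rewrite -perm_mxM tperm2 perm_mx1.
have PO : GLO P := GLO_intro Pi Pi PP.
have [_ Pu _] := PO.
have pV0 : p^-1 != 0 by rewrite invr_eq0 p0.
(* [P] swaps the first two basis vectors: [C1] divides the second vector of [C] by p, while [C *m D]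
   multiplies the first by p. Hence C D < C < C1 < p^-1 C D. *)
pose C1 := C *m P *m Dx p^-1.
have C1u : C1 \in unitmx by rewrite !unitmx_mul Cu Pu Dx_unitmx.
have C1E : lat (C1 *m D) = lat C.
  by rewrite /C1 -!mulmxA Dx_mul mulVf ?p0 // Dx1 mulmx1 lat_GLO.
have d1 : vz (\det C) = vz (\det C1) + 1.
  by rewrite -(vz_detD C1u) -(lat_eq_vz (mulDu C1u) Cu C1E).
have C3u : p^-1 *: (C *m D) \in unitmx by rewrite unitmx_scale ?mulDu.
exists [set w : vertex | [\/ val w = lattice_class (lat (C *m D)),
    val w = lattice_class (lat C) | val w = lattice_class (lat C1)]].
  exists (lat (C *m D)), (lat C), (lat C1), p; split; split=> //.
  - by exists (C *m D) => //; exact: mulDu.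
  - by exists C.
  - by exists C1.
  - exact: neighbour_proper.
  - by rewrite -C1E; exact: neighbour_proper.
  - rewrite scaled_lat; split.
      apply/lat_sub => //.
      have -> : C1 = p^-1 *: (C *m D) *m (p *: (Dx p^-1 *m P *m Dx p^-1)).
        rewrite -scalemxAl -scalemxAr scalerA mulVf ?p0 // scale1r !mulmxA.
        by rewrite -(mulmxA C D) Dx_mul mulfV ?p0 // Dx1 mulmx1.
      rewrite mulKmx //; apply/mxOverP => i j; rewrite mxE -mulmxA DxM.
      have -> : (P *m Dx p^-1) i j = P i j * (if j == 0 then p^-1 else 1).
        by rewrite mul_mx_diag !mxE.
      have pi := uniformizer_intg p_unif; have /mxOverP/(_ i j) Pij := Pi.
      case: eqP => [i0|_]; case: eqP => [j0|_].
      - have E1 : (inord 1 == 0 :> 'I_3) = false by rewrite -val_eqE /= inordK.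
        by rewrite i0 j0 !mxE tpermL E1 mul0r !mulr0 rpred0.
      - by rewrite mulr1 mulVKf ?p0.
      - by rewrite mul1r mulrCA mulfV ?p0 // mulr1.
      - by rewrite mul1r mulr1 rpredM.
    move=> /(lat_sub_vz C3u C1u); rewrite vz_detZ ?mulDu // vz_detD // d1 vzV ?p0 //.
    by rewrite (vz_uniformizer p_unif); move: (vz _); clear; lia.
by move=> w [->|->]; [constructor 1|constructor 2].
Qed.

End BuildingEdges.

(** * The Tits complex *)

Lemma tits_relation (q : nat) (F : finFieldType) (x y z : tits_P q F) :
  tits_triple x y z -> (tits_gen x * tits_gen y * tits_gen z = 1)%g.
Proof.
move=> xyz.
pose R := @tits_relator q F.
apply: etrans (congr1 (fun t => pres_mul t _) (pres_mulE R [:: (true, x)] [:: (true, y)])) _.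
apply: etrans (pres_mulE R ([:: (true, x)] ++ [:: (true, y)]) [:: (true, z)]) _.
by apply/eqP/pres_eqP/word_equiv_relator; exists x, y, z.
Qed.

Section TitsEdges.
Variables (K : nonarchLocalFieldType) (p : K).
Hypothesis p_unif : uniformizer p.
Variables (q : nat) (F : finFieldType).
Variable Phi : tits_building q F -> building K.
Hypothesis Phi_iso : directed_isomorphism Phi.
Local Notation intm := (mxOver (@intg K)).
Local Notation maxm := (mxOver (@maxid K)).
Local Notation V := 'cV[K]_3.
Local Notation e0 := (delta_mx 0 0 : 'cV[K]_3).
Local Notation p0 := (uniformizer_neq0 p_unif).
Local Notation D := (Dx p).
Local Notation gen := (@tits_gen q F).
Local Notation P := (tits_P q F).
Implicit Types a b : tits_group q F.

Lemma Phi_edge a x : exists C, edge_basis p C (Phi a) (Phi (a * gen x)%g).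
Proof.
have [_ _ edge] := Phi_iso.
by apply: (building_edge_basis p_unif); apply: edge; exists x.
Qed.

Lemma Phi_inj : injective Phi.
Proof. by have [/bij_inj] := Phi_iso. Qed.

Lemma Phi_surj (v : building_vertex K) : exists a, Phi a = v.
Proof. by have [[g _ gK] _ _] := Phi_iso; exists (g v); rewrite gK. Qed.

(** [Phi] carries edges forward and simplices both ways. The preimage of an edge lies in a chamber,
    whose vertices are joined cyclically by generators; the wrong direction would contradict
    [edge_basis_asym]. *)
Lemma Phi_edge_gen a b C : edge_basis p C (Phi a) (Phi b) -> exists x, b = (a * gen x)%g.
Proof.
move=> eC; have [c cc abc] := edge_basis_chamber p_unif eC.
have [_ simp _] := Phi_iso.
have ab : simplex ([set a; b] : set (tits_building q F)).
  apply/simp; split; first by exists (Phi a); exists a => //; left.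
  by exists c => // _ [d [->|->] <-]; apply: abc; [left|right].
have [_ [_ [a' [x [y [z [xyz ->]]]]] sab]] := ab.
have aE := sab a (or_introl erefl); have bE := sab b (or_intror erefl).
have zE : (a' * gen x * gen y * gen z = a')%g.
  by rewrite -!mulgA (mulgA (gen x)) (tits_relation xyz) mulg1.
have nn : a <> b by move=> E; move: eC; rewrite E; exact: (edge_basis_irrefl p_unif).
have bad w : a <> (b * gen w)%g.
  move=> E; have [C' eC'] := Phi_edge b w; rewrite -E in eC'.
  exact: (edge_basis_asym p_unif eC eC').
move: aE bE => /= [[aE|aE]|aE] [[bE|bE]|bE].
- by case: nn; rewrite aE bE.
- by exists x; rewrite aE bE.
- by case: (bad z); rewrite aE bE zE.
- by case: (bad x); rewrite aE bE.
- by case: nn; rewrite aE bE.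
- by exists y; rewrite aE bE.
- by exists z; rewrite aE bE zE.
- by case: (bad y); rewrite aE bE.
- by case: nn; rewrite aE bE.
Qed.

Definition side a b : set (P2 K) := between p (Phi a) (Phi b).

Lemma continuous_side a x : indicator (side a (a * gen x)%g) \in @continuous_int K.
Proof.
have [C eC] := Phi_edge a x; have [Cu _ _] := eC.
have -> : side a (a * gen x)%g = jump (lat (C *m D)) (lat C).
  by apply/seteqP; split=> xi; rewrite /side /= (betweenE p_unif _ eC).
exact: continuous_indicator.
Qed.

(* The line of [xi] grows exactly once along [L0 < L1 < L2 < p^-1 L0]. *)
Lemma side_triangle a x y z xi : tits_triple x y z ->
  indicator (side a (a * gen x)%g) xi +
  indicator (side (a * gen x)%g (a * gen x * gen y)%g) xi +
  indicator (side (a * gen x * gen y)%g a) xi = 1.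
Proof.
move=> xyz.
have zE : (a * gen x * gen y * gen z = a)%g.
  by rewrite -!mulgA (mulgA (gen x)) (tits_relation xyz) mulg1.
have [C1 e1] := Phi_edge a x; have [C1u aE1 _] := e1.
have [C2 [+ axE]] : exists C2,
    edge_basis p C2 (Phi (a * gen x)%g) (Phi (a * gen x * gen y)%g) /\
    lat (C2 *m D) = lat C1.
  have [C2 e2] := Phi_edge (a * gen x)%g y.
  by have [_ _ vE] := e1; have [C ? ?] := edge_basis_source e2 C1u vE; exists C.
move=> e2; have [C2u _ _] := e2.
have [C3 [e3 axyE]] : exists C3,
    edge_basis p C3 (Phi (a * gen x * gen y)%g) (Phi a) /\ lat (C3 *m D) = lat C2.
  have [C3] := Phi_edge (a * gen x * gen y)%g z; rewrite zE => e3.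
  by have [_ _ vE] := e2; have [C ? ?] := edge_basis_source e3 C2u vE; exists C.
have [C3u _ aE3] := e3.
have CDu (C : 'M[K]_3) : C \in unitmx -> C *m D \in unitmx by exact: mulDu.
have [s s0 sE] := lattice_class_eq (etrans (esym aE1) aE3).
have sCu : s *: (C1 *m D) \in unitmx by rewrite unitmx_scale ?CDu.
(* Each of the three steps lowers v(det) by 1, so the scalar closing the triangle has valuation -1:
   the top lattice [lat C3] is p^-1 times the bottom one [lat (C1 *m D)]. *)
have vs : vz s = -1.
  have := lat_eq_vz C3u sCu sE; rewrite vz_detZ ?CDu //.
  have := lat_eq_vz (CDu _ C2u) C1u axE; have := lat_eq_vz (CDu _ C3u) C2u axyE.
  rewrite !(vz_detD p_unif) //.
  move: (vz s) (vz (\det C1)) (vz (\det C2)) (vz (\det C3)) => u1 u2 u3 u4.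
  by clear; lia.
have pE : lat (p *: C3) = lat (C1 *m D).
  rewrite -scaled_lat sE scaled_lat scalerA lat_unitZ ?CDu //.
  by rewrite intguE mulf_neq0 ?p0 // vzM ?p0 // vs (vz_uniformizer p_unif).
have [C [Cu CC3 xiE]] := line_basis xi C3u.
have pCE : lat (p *: C) = lat (C1 *m D) by rewrite -scaled_lat CC3 scaled_lat.
have s1 := lat_Dx_sub p_unif C1u; have s2 := lat_Dx_sub p_unif C2u.
have s3 := lat_Dx_sub p_unif C3u; rewrite axE in s2; rewrite axyE in s3.
have j1 := betweenE p_unif xi e1; have j2 := betweenE p_unif xi e2.
have j3 := betweenE p_unif xi e3.
rewrite (jump_basis p_unif (CDu _ C1u) C1u Cu xiE) ?pCE ?CC3 // in j1; last first.
  exact: subset_trans s2 s3.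
rewrite axE (jump_basis p_unif C1u C2u Cu xiE) ?pCE ?CC3 // in j2.
rewrite axyE (jump_basis p_unif C2u C3u Cu xiE) ?pCE ?CC3 // in j3; last first.
  exact: subset_trans s1 s2.
have v3 : lat C3 (C *m e0).
  by rewrite -CC3 -[C *m e0]scale1r; apply/lat_scale_e0; rewrite ?rpred1.
have v0 : ~ lat (C1 *m D) (C *m e0).
  rewrite -pCE; have -> : C *m e0 = p *: (p^-1 *: (C *m e0)).
    by rewrite scalerA mulfV ?p0 // scale1r.
  move=> /(latZ_lat _ _ p0)/lat_scale_e0 => /(_ Cu).
  by rewrite -[p^-1]mulr1 -maxidP // (negbTE (maxid1 K)).
rewrite /indicator /side.
(* [C *m e0] lies in the top lattice and not in the bottom one; the indicator equal to 1 belongs to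
   the step at which this vector enters. *)
have [v2|v2] := pselect (lat C2 (C *m e0)); last first.
  have v1 : ~ lat C1 (C *m e0) by move/s2.
  rewrite (asboolF (_ : ~ between p (Phi a) _ xi)); last by move/j1 => [].
  rewrite (asboolF (_ : ~ between p _ (Phi (a * gen x * gen y)%g) xi)); last by move/j2 => [].
  by rewrite asboolT // j3.
rewrite (asboolF (_ : ~ between p _ (Phi a) xi)); last by move/j3 => [].
have [v1|v1] := pselect (lat C1 (C *m e0)).
  rewrite (asboolF (_ : ~ between p _ (Phi (a * gen x * gen y)%g) xi)); last by move/j2 => [].
  by rewrite asboolT // j1.
rewrite (asboolF (_ : ~ between p (Phi a) _ xi)); last by move/j1 => [].
by rewrite asboolT // j2.
Qed.

Lemma vertex_of_lattice (B : 'M[K]_3) : B \in unitmx ->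
  exists a, val (Phi a) = lattice_class (lat B).
Proof.
move=> Bu.
have H : lattice_class (lat B) \in [set lattice_class L | L in [set L | @is_lattice K L]].
  by apply/mem_set; exists (lat B) => //; exists B.
pose v : building_vertex K := exist
  (fun U => U \in [set lattice_class L | L in [set L | @is_lattice K L]]) _ H.
by have [a aE] := Phi_surj v; exists a; rewrite aE.
Qed.

Lemma vertex_lattice (v : building_vertex K) :
  exists2 B, B \in unitmx & val v = lattice_class (lat B).
Proof. by have /set_mem[L [B Bu ->] <-] := valP v; exists B. Qed.

(** * Neighbours of a vertex and the projective plane over the residue field *)

Section Counting.
Variable r : 'I_q -> K.
Hypothesis r_intg : forall i, r i \in @intg K.
Hypothesis r_inj : forall i j, r i - r j \in @maxid K -> i = j.
Hypothesis card_P : #|{: P}| = (q ^ 2 + q + 1)%N.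
Local Notation pvec := (point_vec r).
Local Notation W := (point_index q).

(** The vectors w_i e_j - w_j e_i are killed by the functional [w]; that [w'] kills them modulo the
    maximal ideal makes the two vectors proportional there. *)
Lemma point_functional_inj (w w' : W) :
  (forall y : V, y \is a intm -> ((pvec w)^T *m y) 0 0 \in @maxid K ->
    ((pvec w')^T *m y) 0 0 \in @maxid K) -> w = w'.
Proof.
move=> ww'; have := point_vec_primitive r_intg w.
case/andP=> wi /existsP[i wiN].
have w'i := point_vec_intm r_intg w'; have w'p := point_vec_primitive r_intg w'.
move/mxOverP: (wi) => wij; move/mxOverP: (w'i) => w'ij.
have wiu := intg_not_maxid (wij i 0) wiN; have wi0 := intgu_neq0 wiu.
pose c := pvec w' i 0 / pvec w i 0.
have cm : c *: pvec w - pvec w' \is a maxm.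
  apply/mxOverP => j k; rewrite (ord1 k) -(maxid_mulu _ wiu) -rpredN.
  pose y : V := pvec w i 0 *: delta_mx j 0 - pvec w j 0 *: delta_mx i 0.
  have yE (u : W) : ((pvec u)^T *m y) 0 0 =
      pvec w i 0 * pvec u j 0 - pvec w j 0 * pvec u i 0.
    rewrite /y mulmxBr -!scalemxAr -!colE; move: (pvec w) (pvec u) => t s.
    by rewrite !mxE.
  have -> : - (pvec w i 0 * (c *: pvec w - pvec w') j 0) = ((pvec w')^T *m y) 0 0.
    rewrite yE /c; move: (pvec w) (pvec w') wi0 => t s t0; rewrite !mxE.
    rewrite mulrBr opprB; congr (_ - _).
    by rewrite mulrA (mulrC (t i 0)) mulfVK // mulrC.
  apply: ww'; last by rewrite yE mulrC subrr rpred0.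
  by rewrite /y rpredB // mxOverZ //; apply/mxOverP => ? ?; rewrite mxE rpred_nat.
have ci : c \in @intg K by rewrite rpredM // intgu_intg // intguV.
have cu : intgu c.
  apply: intg_not_maxid => //; apply/negP => cmax.
  move: w'p; rewrite primitiveE => /andP[_ /negP]; apply.
  have -> : pvec w' = c *: pvec w - (c *: pvec w - pvec w').
    by rewrite opprB addrC subrK.
  by rewrite rpredB //; apply/mxOverP => k l; rewrite mxE maxidMr.
by have [] := point_vec_inj r_intg r_inj cu cm.
Qed.

(** Sublattices of index q are kernels of nonzero functionals modulo the maximal ideal. Completing
    [pvec w] to a basis of the dual lattice realizes its kernel as [lat (C1 *m D)]. *)
Lemma left_neighbour (C : 'M[K]_3) (w : W) : C \in unitmx ->
  exists2 C1, C1 \in unitmx & lat C1 = lat C /\ forall y : V, y \is a intm ->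
    lat (C1 *m D) (C *m y) <-> ((pvec w)^T *m y) 0 0 \in @maxid K.
Proof.
move=> Cu; have [G GO Ge] := primitive_completion (point_vec_primitive r_intg w).
have HO := GLO_tr GO; have HVO := GLO_inv HO; have [HVi HVu _] := HVO.
have [Hi Hu _] := HO.
have C1u : C *m invmx G^T \in unitmx by rewrite unitmx_mul Cu.
have C1Du : C *m invmx G^T *m D \in unitmx by exact: mulDu.
exists (C *m invmx G^T) => //; split; first exact: lat_GLO.
move=> y yi; rewrite latP //.
have -> : C *m y = C *m invmx G^T *m D *m (Dx p^-1 *m (G^T *m y)).
  rewrite -!mulmxA (mulmxA D) Dx_mul mulfV ?p0 // Dx1 mul1mx.
  by rewrite (mulmxA (invmx _)) mulVmx // mul1mx.
rewrite mulKmx //.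
have -> : ((pvec w)^T *m y) 0 0 = (G^T *m y) 0 0.
  by rewrite -Ge trmx_mul trmx_delta -mulmxA -rowE mxE.
rewrite (maxidP p_unif); split=> [/mxOverP/(_ 0 0)|h].
  by rewrite DxM eqxx.
apply/mxOverP => i j; rewrite (ord1 j) DxM; case: eqP => [->//|_].
by rewrite mul1r; have /mxOverP := mxOverM Hi yi; apply.
Qed.

(** Distinct points [w] give distinct neighbours, and P has as many elements as there are points, so
    [f] is bijective. As the neighbours determine [w], the generators are pairwise distinct in the
    group, a fact not visible in the presentation. *)
Lemma left_neighbour_index (C : 'M[K]_3) : C \in unitmx ->
  val (Phi 1%g) = lattice_class (lat C) ->
  exists f : W -> P, [/\ bijective f, injective gen & forall w,
    exists C1, [/\ edge_basis p C1 (Phi (gen (f w))^-1%g) (Phi 1%g), lat C1 = lat C &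
      forall y : V, y \is a intm ->
        lat (C1 *m D) (C *m y) <-> ((pvec w)^T *m y) 0 0 \in @maxid K]].
Proof.
move=> Cu PE.
have /choice[f fP] (w : W) : exists x : P,
    exists C1, [/\ edge_basis p C1 (Phi (gen x)^-1%g) (Phi 1%g), lat C1 = lat C &
      forall y : V, y \is a intm ->
        lat (C1 *m D) (C *m y) <-> ((pvec w)^T *m y) 0 0 \in @maxid K].
  have [C1 C1u [C1E h]] := left_neighbour w Cu.
  have [b bE] := vertex_of_lattice (mulDu p_unif C1u).
  have e1 : edge_basis p C1 (Phi b) (Phi 1%g) by split=> //; rewrite PE C1E.
  have [x xE] := Phi_edge_gen e1.
  exists x, C1; split=> //.
  by have -> : (gen x)^-1%g = b by apply: (mulIg (gen x)); rewrite mulVg.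
have inj w w' : Phi (gen (f w))^-1%g = Phi (gen (f w'))^-1%g -> w = w'.
  move=> E; have [C1 [e1 E1 h1]] := fP w; have [C2 [e2 E2 h2]] := fP w'.
  have [C1u u1 _] := e1; have [C2u u2 _] := e2.
  have [a a0 aE] := lattice_class_eq (etrans (esym u1) (etrans (congr1 val E) u2)).
  have C1Du := mulDu p_unif C1u; have C2Du := mulDu p_unif C2u.
  have aCu : a *: (C1 *m D) \in unitmx by rewrite unitmx_scale.
  have va : vz a = 0.
    have := lat_eq_vz C2Du aCu aE; rewrite vz_detZ // !(vz_detD p_unif) //.
    rewrite (lat_eq_vz C1u Cu E1) (lat_eq_vz C2u Cu E2).
    by move: (vz a) (vz (\det C)) => x y; clear; lia.
  rewrite lat_unitZ // in aE; last exact: vz0_intgu.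
  by apply: point_functional_inj => y yi /(h1 y yi); rewrite -aE => /(h2 y yi).
have finj : injective f by move=> w w' E; apply: inj; rewrite E.
have fbij : bijective f.
  by apply: inj_card_bij => //; rewrite card_P (card_point_index q).
exists f; split=> // x x' E; have [g _ gK] := fbij.
by rewrite -(gK x) -(gK x'); congr f; apply: inj; rewrite !gK E.
Qed.

Lemma gen_inj : injective gen.
Proof.
have [B Bu BE] := vertex_lattice (Phi 1%g).
by have [f []] := left_neighbour_index Bu BE.
Qed.

(** In a basis adapted to the line, it grows from the sublattice of [w] exactly when the functional
    [w] does not kill [e0] modulo the maximal ideal. These are the q^2 points (1, a, b). *)
Lemma side_left_sum xi : \sum_(x : P) indicator (side (gen x)^-1%g 1%g) xi = (q ^ 2)%:Z.
Proof.
have [B Bu BE] := vertex_lattice (Phi 1%g).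
have [C [Cu CB xiE]] := line_basis xi Bu; rewrite -CB in BE.
have [f [fbij _ fP]] := left_neighbour_index Cu BE.
have e0i : e0 \is a intm by apply/mxOverP => i j; rewrite mxE rpred_nat.
rewrite (reindex f) /=; last exact: onW_bij.
transitivity (\sum_(w : W) (point_entry r w 0 \notin @maxid K : nat)%:Z).
  apply: eq_bigr => w _; have [C1 [e1 E1 h1]] := fP w; have [C1u _ _] := e1.
  rewrite /indicator /side; congr (nat_of_bool _)%:Z.
  have -> : point_entry r w 0 = ((pvec w)^T *m e0) 0 0 by rewrite -colE !mxE.
  apply/asboolP/negP; rewrite (betweenE p_unif xi e1).
    by move/(jump_neighbour p_unif C1u Cu (esym E1) xiE) => h /(h1 _ e0i).
  by move=> h; apply/(jump_neighbour p_unif C1u Cu (esym E1) xiE) => /(h1 _ e0i).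
rewrite !big_sumType /= (eq_bigr (fun=> 1)); last first.
  by move=> [a b] _; rewrite /= (negbTE (maxid1 K)).
rewrite [X in _ + X + _]big1; last by move=> a _; rewrite rpred0.
rewrite [X in _ + X]big1; last by move=> a _; rewrite rpred0.
by rewrite !addr0 sumr_const card_prod card_ord natz.
Qed.

(** The one neighbour is [lat C1], obtained by dividing the basis vector on the line by p. A lattice
    containing [lat C] with index q in which the line grows contains the divided vector, hence
    [lat C1], and equals it by comparing determinants. *)
Lemma side_right_sum xi : \sum_(x : P) indicator (side 1%g (gen x)) xi = 1.
Proof.
have [B Bu BE] := vertex_lattice (Phi 1%g).
have [C [Cu CB xiE]] := line_basis xi Bu; rewrite -CB in BE.
have pV0 : p^-1 != 0 by rewrite invr_eq0 p0.
pose C1 := C *m Dx p^-1.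
have C1u : C1 \in unitmx by rewrite unitmx_mul Cu Dx_unitmx.
have C1D : C1 *m D = C by rewrite -mulmxA Dx_mul mulVf ?p0 // Dx1 mulmx1.
have C1e : C1 *m e0 = p^-1 *: (C *m e0).
  rewrite /C1 -mulmxA [RHS]scalemxAr; congr (_ *m _); apply/matrixP => i j.
  by rewrite DxM !mxE; case: eqP => _; rewrite ?mul1r ?mulr0.
have nC1e : ~ lat C (p^-1 *: (C *m e0)).
  move/lat_scale_e0 => /(_ Cu).
  by rewrite -[p^-1]mulr1 -maxidP // (negbTE (maxid1 K)).
have J1 : jump (lat (C1 *m D)) (lat C1) xi.
  exists (C1 *m e0); first by rewrite xiE C1e memvZ // memv_line.
  split; last by rewrite C1D C1e.
  by rewrite -[C1 *m e0]scale1r; apply/lat_scale_e0; rewrite ?rpred1.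
have [b bE] := vertex_of_lattice C1u.
have e1 : edge_basis p C1 (Phi 1%g) (Phi b) by split; rewrite ?C1D.
have [x xE] := Phi_edge_gen e1; rewrite mul1g in xE.
have uniq y : side 1%g (gen y) xi -> y = x.
  move=> [C2 e2']; have [C2u' uE' _] := e2'.
  have [a a0 aE] := lattice_class_eq (etrans (esym uE') BE).
  rewrite -(jumpZ _ _ _ a0) scalemxAl => J2.
  have e2 := edge_basisZ a0 e2'; rewrite scalemxAl in aE.
  move: (a *: C2) e2 aE J2 => C3 e3 C3E; rewrite -C3E => -[v].
  have [C3u _ vE3] := e3.
  rewrite xiE => /vlineP[c ->] [h1 h2].
  have cN : c \notin @intg K by apply/negP => ci; apply: h2; apply/lat_scale_e0.
  have c0 : c != 0 by apply: contraNneq cN => ->; rewrite rpred0.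
  have vc : vz c < 0 by move: cN; rewrite intgE (negbTE c0) /= ltNge.
  have l3 : lat C3 (p^-1 *: (C *m e0)).
    have -> : p^-1 *: (C *m e0) = (p^-1 / c) *: (c *: (C *m e0)).
      by rewrite scalerA mulfVK.
    apply: latZ => //; rewrite intgE mulf_eq0 !invr_eq0 (negbTE c0) (negbTE p0) /=.
    rewrite vzM ?invr_eq0 ?p0 // !vzV ?p0 // (vz_uniformizer p_unif).
    by move: vc; move: (vz c) => k; clear; lia.
  have CC3 : lat C `<=` lat C3 by rewrite C3E; exact: lat_Dx_sub.
  have sub : lat C1 `<=` lat C3.
    move=> _ [z zi <-].
    have -> : C1 *m z = z 0 0 *: (p^-1 *: (C *m e0)) + C *m (z - z 0 0 *: e0).
      rewrite !scalemxAr -mulmxDr /C1 -mulmxA; congr (_ *m _).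
      apply/matrixP => i j; rewrite (ord1 j) DxM .
      have -> : (z 0 0 *: (p^-1 *: e0) + (z - z 0 0 *: e0)) i 0 =
          z 0 0 * (p^-1 * (i == 0)%:R) + (z i 0 - z 0 0 * (i == 0)%:R).
        by rewrite !mxE !andbT.
      case: eqP => [->|_]; last by rewrite mul1r !mulr0 subr0 add0r.
      by rewrite !mulr1 subrr addr0 mulrC.
    apply: latD => //; first by apply: latZ => //; exact: (zi 0).
    apply/CC3/lat_mul; rewrite rpredB ?mxOverZ //.
    - by apply/mxOverP => i j; rewrite (ord1 j); exact: zi.
    - exact: zi.
    - by apply/mxOverP => i j; rewrite mxE rpred_nat.
  have E31 : lat C3 = lat C1.
    apply/esym/lat_sub_eq => //.
    have := lat_eq_vz Cu (mulDu p_unif C3u) C3E.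
    by rewrite -C1D !(vz_detD p_unif) // => /addIr.
  apply: gen_inj; rewrite -xE; apply: Phi_inj; apply: val_inj.
  by rewrite vE3 E31 -bE.
have sx : side 1%g (gen x) xi.
  by rewrite /side -xE; apply/(betweenE p_unif xi e1).
rewrite (bigD1 x) //= big1 ?addr0; first by rewrite /indicator asboolT.
by move=> y yx; rewrite /indicator asboolF // => /uniq E; rewrite E eqxx in yx.
Qed.

End Counting.

End TitsEdges.

(** * The upper bound *)

Section FiniteField.
Variables (q : nat) (F : finFieldType).
Hypothesis q_gt1 : (1 < q)%N.
Hypothesis card_F : #|F| = (q ^ 3)%N.
Local Notation U := ([set: {unit F}]%SET).
Local Notation H := (subfield_units q F).

Lemma cube_pred : (q ^ 3).-1 = ((q ^ 2 + q + 1) * (q - 1))%N.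
Proof. by rewrite -(subnK (ltnW q_gt1)) addnK; move: (q - 1)%N => n; lia. Qed.

Lemma unitF_cyclic : cyclic U.
Proof. exact: field_unit_group_cyclic. Qed.

(** In the cyclic group F^* the equation u^q = u says u^(q-1) = 1, and q - 1 divides the order q^3 -
    1. *)
Lemma card_subfield_units : #|H| = (q - 1)%N.
Proof.
have [g gE] := cyclicP unitF_cyclic.
have og : #[g]%g = ((q ^ 2 + q + 1) * (q - 1))%N.
  by rewrite orderE -gE card_finField_unit card_F cube_pred.
have -> : H = <[g ^+ (q ^ 2 + q + 1)]>%g.
  have HE (u : {unit F}) : (u \in H) = (u ^+ (q - 1) == 1)%g.
    rewrite inE -{1}(subnK (ltnW q_gt1)) expgD expg1.
    by apply/eqP/eqP => [E|->]; [apply: (mulIg u); rewrite E mul1g|rewrite mul1g].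
  apply/setP => u; rewrite HE; apply/idP/idP => [|/cycleP[k ->]].
    have : u \in <[g]>%g by rewrite -gE inE.
    move=> /cycleP[k ->]; rewrite -expgM -order_dvdn og dvdn_pmul2r ?subn_gt0 //.
    by move=> /dvdnP[l ->]; rewrite mulnC expgM mem_cycle.
  by rewrite -!expgM -order_dvdn og (mulnC k) mulnA dvdn_mulr.
by rewrite -orderE orderXdiv og ?dvdn_mulr // mulKn // addn1.
Qed.

Lemma card_tits_P : #|{: tits_P q F}| = (q ^ 2 + q + 1)%N.
Proof.
have NT : 'N(H)%g = U.
  apply/eqP; rewrite finset.eqEsubset finset.subsetT /=.
  by apply: fintype.subset_trans (cent_sub _); apply/centsP => u _ v _; apply: val_inj; rewrite /= mulrC.
rewrite -cardsT -im_quotient NT card_quotient ?NT //.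
rewrite -divgS ?finset.subsetT // card_finField_unit card_F card_subfield_units cube_pred.
by rewrite mulnK // subn_gt0.
Qed.

Lemma exists_trace_zero : exists xi : tits_P q F, trace_zero xi.
Proof.
have [u uN] : exists u : {unit F}, u \notin H.
  apply/existsP; rewrite -negb_forall; apply/negP => /forallP h.
  have : (#|U| <= #|H|)%N by apply/subset_leq_card/fintype.subsetP => u _.
  rewrite card_finField_unit card_F card_subfield_units cube_pred.
  by rewrite leqNgt ltn_Pmull // ?subn_gt0 //; lia.
(* The trace of b^q - b telescopes to b^(q^3) - b = 0, and this element is nonzero for [b] outside
   F_q. *)
pose b := FinRing.uval u; pose c := b ^+ q - b.
have c0 : c \is a GRing.unit.
  rewrite unitfE subr_eq0; apply: contra uN => /eqP E; rewrite inE; apply/eqP.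
  by apply: val_inj; rewrite /= -[RHS]E FinRing.val_unitX.
have [p p_pr p_char] := finPcharP F.
(* The q-power map is additive, because a prime power q^3 = #|F| makes q a power of the
   characteristic. *)
have qn : [pchar F].-nat q.
  rewrite (eq_pnat _ (pcharf_eq p_char)).
  have : p.-nat (q ^ 3)%N by rewrite -card_F (card_pprimeChar p_char) pnatX pnat_id.
  by rewrite pnatX orbF.
exists (coset _ (FinRing.unit F c0)); exists (FinRing.unit F c0) => //=.
have bq3 : b ^+ (q ^ 3) = b by rewrite -card_F expf_card.
have qn2 : [pchar F].-nat (q ^ 2)%N by rewrite pnatX qn.
rewrite /frob_trace /c !exprDn_pchar // !exprNn_pchar // -!exprM mulnn -expnS bq3.
by move: (b ^+ q) (b ^+ (q ^ 2)) => x y; ring.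
Qed.

End FiniteField.

(** * Equivariance of the sets of lines attached to edges *)

Section Equivariance.
Variables (K : nonarchLocalFieldType) (p : K).
Hypothesis p_unif : uniformizer p.
Local Notation V := 'cV[K]_3.
Local Notation D := (Dx p).

Lemma lat_mull (A B : 'M[K]_3) x : A \in unitmx ->
  lat (A *m B) x <-> lat B (invmx A *m x).
Proof.
move=> Au; split=> [[z zi <-]|[z zi E]]; exists z => //.
  by rewrite -mulmxA mulKmx.
by rewrite -mulmxA E mulKVmx.
Qed.

Lemma image_lattice_class (A B : 'M[K]_3) :
  [set mulmx A @` L | L in lattice_class (lat B)] = lattice_class (lat (A *m B)).
Proof.
have E a : mulmx A @` scaled a (lat B) = scaled a (lat (A *m B)).
  rewrite !scaled_lat; apply/seteqP; split=> y.
    by move=> [_ [z zi <-] <-]; exists z => //; rewrite mulmxA -scalemxAr.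
  move=> [z zi <-]; exists (a *: B *m z); first by exists z.
  by rewrite mulmxA -scalemxAr.
apply/seteqP; split=> [_ [_ [a a0 <-] <-]|_ [a a0 <-]]; first by exists a.
by exists (scaled a (lat B)) => //; exists a.
Qed.

Lemma edge_basis_act g C (u v : building_vertex K) : edge_basis p C u v ->
  edge_basis p (val (repr g) *m C) (building_act g u) (building_act g v).
Proof.
move=> [Cu uE vE]; split.
- by rewrite unitmx_mul (valP (repr g)).
- by rewrite /= uE image_lattice_class mulmxA.
- by rewrite /= vE image_lattice_class.
Qed.

Lemma between_act g C (u v : building_vertex K) xi : edge_basis p C u v ->
  between p (building_act g u) (building_act g v) xi <->
  between p u v (P2_act g^-1%g xi).
Proof.
move=> eC; rewrite (betweenE p_unif _ (edge_basis_act g eC)) (betweenE p_unif _ eC).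
set A := val (repr g); have Au : A \in unitmx := valP (repr g).
(* The chosen representatives of [g] and of its inverse are inverse to each other only up to a
   scalar, which does not move lines. *)
have [c c0 cE] : exists2 c : K, c != 0 & val (repr g^-1%g) = c *: invmx A.
  by have := pgl_reprP (repr g)^-1%g; rewrite -pgl_invE reprK.
rewrite -mulmxA; split=> -[x xxi [h1 h2]].
  exists (invmx A *m x).
    have -> : invmx A *m x = c^-1 *: linfun (mulmx (val (repr g^-1%g)) : V -> V) x.
      by rewrite lfunE /= cE -scalemxAl scalerA mulVf // scale1r.
    by rewrite memvZ // memv_img.
  by split; [apply/lat_mull|move/(lat_mull _ _ Au)].
move: xxi => /memv_imgP[y yxi xE]; exists (c *: y); first by rewrite memvZ.
have {}xE : x = invmx A *m (c *: y).
  by rewrite xE lfunE /= cE -scalemxAl scalemxAr.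
rewrite xE in h1 h2.
by split; [apply/lat_mull|move/(lat_mull _ _ Au)].
Qed.

End Equivariance.

Lemma coinvariant_class_act (K : nonarchLocalFieldType) (Gamma : {pred PGL3 K}) g f :
  g \in Gamma -> coinvariant_class Gamma (CP2_act g f) = coinvariant_class Gamma f.
Proof.
move=> gG; apply/eqP; rewrite -subr_eq0 /coinvariant_class -raddfB; apply/eqP.
apply/coinvariant_class_eq0/asboolP => S _ _; exact.
Qed.

Section UpperBound.
Variables (K : nonarchLocalFieldType) (q : nat) (F : finFieldType).
Hypothesis Kq : (residue_field K #= `I_q)%card.
Hypothesis card_F : #|F| = (q ^ 3)%N.
Variable Gamma : {pred PGL3 K}.
Hypothesis q_gt1 : (1 < q)%N.

Lemma coinvariant_class_order_le : tits_type q F Gamma ->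
  coinvariant_class Gamma (CP2_one K) *+ (q - 1) = 0.
Proof.
move=> [phi [Phi [_ phiG Phi_iso PhiM]]].
have [p p_unif] := exists_uniformizer K.
have [r [r_intg r_inj r_surj]] := residue_representatives Kq.
have cP := card_tits_P q_gt1 card_F.
pose gen := @tits_gen q F.
(* The default 0 of [insubd] is not met on the edges (a, a x), where the indicator is continuous;
   only these are used. *)
pose ind a b : CP2 K := insubd 0 (indicator (side p Phi a b)).
have val_ind a x : val (ind a (a * gen x)%g) = indicator (side p Phi a (a * gen x)%g).
  by rewrite insubdK //; exact: continuous_side.
pose cl := coinvariant_class Gamma.
have clD f g : cl (f + g) = cl f + cl g by rewrite /cl /coinvariant_class raddfD.
have cl_sum (f : tits_P q F -> CP2 K) : cl (\sum_x f x) = \sum_x cl (f x).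
  by rewrite /cl /coinvariant_class raddf_sum.
have clMn f n : cl (f *+ n) = cl f *+ n by rewrite /cl /coinvariant_class raddfMn.
(* Left translation acts through [phi b], an element of [Gamma], so the class of the indicator
   depends only on the label of the edge. *)
have move_ind b a x : cl (ind (b * a)%g (b * a * gen x)%g) = cl (ind a (a * gen x)%g).
  have bG : phi b \in Gamma by apply/phiG; exists b.
  rewrite /cl -(coinvariant_class_act (ind a (a * gen x)%g) bG); congr coinvariant_class.
  apply: val_inj; rewrite /= !val_ind; apply/funext => xi.
  have [C eC] := Phi_edge p_unif Phi_iso a x.
  rewrite /indicator /side; congr (nat_of_bool _)%:Z; apply: asbool_equiv_eq.
  by have := between_act p_unif (phi b) xi eC; rewrite -!PhiM mulgA.
pose e x := cl (ind 1%g (gen x)); pose eps := cl (CP2_one K).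
have eE a x : cl (ind a (a * gen x)%g) = e x.
  by have := move_ind a 1%g x; rewrite !mulg1 mul1g.
have val_sum (f : tits_P q F -> CP2 K) xi : val (\sum_x f x) xi = \sum_x val (f x) xi.
  by rewrite raddf_sum /=; elim/big_rec2: _ => // i y1 y2 _ <-.
have valD f g xi : val (f + g : CP2 K) xi = val f xi + val g xi by [].
have val_one n xi : val (CP2_one K *+ n) xi = n%:Z.
  by elim: n => // n IHn; rewrite mulrS valD IHn -PoszD.
have sum_right : \sum_x e x = eps.
  rewrite /e -cl_sum; congr cl; apply: val_inj; apply/funext => xi.
  rewrite val_sum /= -(side_right_sum p_unif Phi_iso r_intg r_inj cP xi).
  by apply: eq_bigr => x _; have := val_ind 1%g x; rewrite mul1g => ->.
(* The edge from x^-1 to 1 also carries the label x, so the same sum can be computed on incoming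
   edges. *)
have sum_left : \sum_x e x = eps *+ (q ^ 2).
  rewrite -clMn; transitivity (cl (\sum_x ind (gen x)^-1%g 1%g)).
    by rewrite cl_sum; apply: eq_bigr => x _; rewrite -(eE (gen x)^-1%g) mulVg.
  congr cl; apply: val_inj; apply/funext => xi.
  rewrite val_sum val_one -(side_left_sum p_unif Phi_iso r_intg r_inj cP xi).
  by apply: eq_bigr => x _; have := val_ind (gen x)^-1%g x; rewrite mulVg => ->.
have triangle x y z : tits_triple x y z -> e x + e y + e z = eps.
  move=> xyz; have zE : (1 * gen x * gen y * gen z = 1)%g.
    by rewrite mul1g (tits_relation xyz).
  rewrite -(eE 1%g x) -(eE (1 * gen x)%g y) -(eE (1 * gen x * gen y)%g z) zE -!clD.
  congr cl; apply: val_inj; apply/funext => xi.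
  have := val_ind (1 * gen x * gen y)%g z; rewrite zE => val3.
  by rewrite !valD !val_ind val3 (side_triangle p_unif Phi_iso 1%g xi xyz).
have [t t0] := exists_trace_zero q_gt1 card_F.
have three : eps *+ 3 = eps *+ (q ^ 2 + q + 1).
  have -> : eps *+ (q ^ 2 + q + 1) =
      \sum_(x : tits_P q F) (e x + e (x * t)%g + e (x * t ^+ q.+1)%g).
    rewrite -cP -sumr_const; apply: eq_bigr => x _.
    by apply/esym/triangle; exists t.
  (* Right translations of the group P are bijections, so each coordinate of the triple runs once
     through P. *)
  have shift s : \sum_x e (x * s)%g = \sum_x e x by rewrite [RHS](reindex_inj (mulIg s)).
  rewrite !big_split /= !shift.
  by rewrite sum_right !mulrS mulr0n addr0 addrA.
(* With q^2 [1] = [1], this splitting turns the right-hand side of [three] into 3 [1] + (q - 1)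
   [1]. *)
have Eq : (q ^ 2 + q + 1 = q ^ 2 + 2 + (q - 1))%N.
  by move: (q ^ 2)%N q_gt1 => n; clear; lia.
move: three; rewrite Eq !mulrnDr -sum_left sum_right -mulrS => /eqP.
by rewrite eq_sym -subr_eq0 addrAC subrr add0r => /eqP.
Qed.

End UpperBound.

Lemma residue_card_gt1 (K : nonarchLocalFieldType) (q : nat) :
  (residue_field K #= `I_q)%card -> (1 < q)%N.
Proof.
move=> Kq; have [r [r_intg _ r_surj]] := residue_representatives Kq.
have [a ha] := r_surj 0 (rpred0 _); have [b hb] := r_surj 1 (rpred1 _).
case: q {Kq r_surj} r r_intg a b ha hb => [|[|//]] r ri a b; first by case: a.
rewrite !ord1 sub0r rpredN => ha hb.
by have := maxid1 K; rewrite -(subrK (r 0) 1) rpredD.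
Qed.

Local Close Scope ring_scope.
Local Open Scope card_scope.

Theorem mainTheorem3 (K : nonarchLocalFieldType) (q : nat)
    (residue_q : residue_field K #= `I_q)
    (F : finFieldType) (card_F : #|F| = (q ^ 3)%N)
    (Gamma : groupClosed (PGL3 K))
    (Gamma_A2tilde : A2tilde_group Gamma)
    (Gamma_tits : tits_type q F Gamma)
    (q_mod3 : q <> 1 %[mod 3]) :
  has_order (coinvariant_class Gamma (CP2_one K)) (q - 1)%N.
Proof.
have q_gt1 := residue_card_gt1 residue_q.
split=> [|m]; first by rewrite subn_gt0.
split=> [|/dvdnP[n ->]]; first exact: (coinvariant_class_order_ge residue_q).
rewrite mulnC mulrnA (coinvariant_class_order_le residue_q card_F q_gt1 Gamma_tits).
by rewrite mul0rn.
Qed.
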